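(* Let $n\in\{1,2,3\}$, let $\Omega\subset\mathbf R^n$ be a domain (open and connected), let $\delta>0$ and let $\varepsilon>0$ be a constant. Let $u\in C^\infty(\Omega\times(0,\delta))$ be a solution of the Donaldson equation $$u_{tt}(n+\Delta u)-\sum_{j=1}^n u_{jt}^2=\varepsilon\quad\text{on }\Omega\times(0,\delta)$$ satisfying $D_x^2u+I_n\ge0$ on $\Omega$ for each $t\in(0,\delta)$. Then the rank of the matrix $D_x^2u(x,t)+I_n$ is the same for all $(x,t)\in\Omega\times(0,\delta)$.
   Context: Points are denoted $(x,t)$ with $x=(x_1,\dots,x_n)\in\Omega$ and $t\in(0,\delta)$. $D_x^2u$ is the $n\times n$ Hessian in the $x$ variables, $\Delta u=\sum_{j=1}^n u_{jj}$ is the Laplacian in the $x$ variables only, subscripts denote partial derivatives, and $I_n$ is the $n\times n$ identity matrix. *)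

(* Defs.v *)
(* Points (x, t) of R^n x R are pairs in 'rV[R]_n * R.
   Functions are total; only their values on the open set under consideration
   matter, since 'D_v f p depends only on the germ of f at p. *)
From mathcomp Require Import all_boot all_order all_algebra.
From mathcomp Require Import boolp classical_sets reals topology normedtype.
From mathcomp Require Import derive.

Set Implicit Arguments.
Unset Strict Implicit.
Unset Printing Implicit Defensive.

Import Order.TTheory GRing.Theory Num.Theory.
Import numFieldNormedType.Exports.

Local Open Scope classical_set_scope.
Local Open Scope ring_scope.

Section SpaceTime.
Context {R : realType} {n : nat}.
Implicit Types (u : 'rV[R]_n * R -> R) (p : 'rV[R]_n * R).

(* Coordinate directions: Some i is the x_i axis, None is the t axis. *)
Definition axis (k : option 'I_n) : 'rV[R]_n * R :=
  if k is Some i then (delta_mx 0 i, 0) else (0, 1).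

Definition partial (k : option 'I_n) u : 'rV[R]_n * R -> R := 'D_(axis k) u.

Definition partials (s : seq (option 'I_n)) u : 'rV[R]_n * R -> R :=
  foldr partial u s.

(* u is C^oo on U: all iterated partial derivatives of u, of every order and in
   every order of differentiation, exist and are continuous at the points of U
   (s = [::] is the continuity of u itself).  Meant for open U. *)
Definition smooth_on (U : set ('rV[R]_n * R)) u : Prop :=
  forall s : seq (option 'I_n), forall p, U p ->
    {for p, continuous (partials s u)} /\
    forall k, derivable (partials s u) p (axis k).

Definition dx (i : 'I_n) u := partial (Some i) u.
Definition dt u := partial None u.

Definition laplacian u p : R := \sum_(j < n) dx j (dx j u) p.

Definition hessian u p : 'M[R]_n := \matrix_(i, j) dx j (dx i u) p.

Definition donaldson (eps : R) u p : Prop :=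
  dt (dt u) p * (n%:R + laplacian u p) - \sum_(j < n) (dt (dx j u) p) ^+ 2
  = eps.

End SpaceTime.

(* A >= 0 for a real symmetric matrix A (the Hessian of a smooth function is
   symmetric, so symmetry is not part of the definition). *)
Definition psd (R : realType) (n : nat) (A : 'M[R]_n) : Prop :=
  forall v : 'rV[R]_n, 0 <= (v *m A *m v^T) 0 0.

(* Main.v *)
From HB Require Import structures.
Require Import Defs.
From mathcomp Require Import all_boot all_order all_algebra ring lra.
From mathcomp Require Import boolp classical_sets set_interval reals topology normedtype.
From mathcomp Require Import derive.

(* Put W = D_x^2 u + I, T = u_tt, s = tr W and g = grad_x u_t, so that
   T s - |g|^2 = eps and the linearized operator
   L = T Delta - 2 g . grad d_t + s d_t^2 is elliptic.  Differentiating the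
   equation twice along a constant vector xi gives
     L (W xi . xi) = 2 (|b - tau g|^2 + eps tau^2),
   where b = grad_x u_(t xi) and tau = (Delta u_xi) / s.  The right-hand side is
   compensated by letting xi move: writing T L as a sum of squares along the
   fields Y_j = T e_j - g_j d_t and eps^(1/2) d_t, there are vectors eta_r,
   linear in the third derivatives of u, such that
     sum_r [D^2_(Y_r) W(xi, xi) + 4 (D_(Y_r) W)(xi, eta_r)
            + 2 W(eta_r, eta_r)] <= 0.
   By a barrier argument the least eigenvalue of W then obeys the strong minimum
   principle, so W is invertible everywhere or nowhere.  This settles n <= 2,
   as tr W > 0.  For n = 3 and W degenerate the same argument applies to
   (tr W) I - W, whose least eigenvalue is the sum of the two smallest ones of
   W: at a null vector xi the inequality above is an equality, which forces
   (D_(Y_r) W) xi = - W eta_r and controls the remaining third derivatives. *)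

(** The least eigenvalue need not be differentiable, so it is only compared with a function phi
    touching it from below at a point p, with unit eigenvector xi. Along p + s y the function W(xi +
    s eta, xi + s eta) - phi |xi + s eta|^2 of s then has minimum 0 at s = 0, for every y and every
    eta, and only its expansion to order two is used. The freedom in eta is essential: with eta = 0
    the second derivatives of phi are bounded by those of W(xi, xi), whose weighted sum is
    nonnegative and quadratic in the third derivatives of u, the wrong sign for a minimum principle
    and not controlled by the gradient of phi. For n = 3 and W degenerate, a touching point of (tr
    W) I - W has an orthonormal frame e1, e2, xi in which W has eigenvalues 0, m, tr W - m. Among
    the entries of D W in this frame, (e1, e1) and (e1, e2) are known because e1 is null, and (e2,
    e2) is the derivative of phi. Only the two entries pairing e1, e2 with xi are free, and moving
    xi cancels exactly these. *)

Set Implicit Arguments.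
Unset Strict Implicit.
Unset Printing Implicit Defensive.

Import Order.TTheory GRing.Theory Num.Theory.
Import numFieldNormedType.Exports.

Local Open Scope classical_set_scope.
Local Open Scope ring_scope.

(** * Second order expansions at 0 *)

Section Jets.
Variable R : realType.
Implicit Types (g h : R -> R) (a b c e s : R).

(** Peano form of the expansion: nothing is asked of g away from 0 beyond the estimate, so sums and
    products need only algebra. The neighbourhood contains s = 0, which forces g 0 = a. *)
Definition jet2 g a b c := forall e, 0 < e ->
  \forall s \near (0 : R), `|g s - (a + b * s + c * s ^+ 2)| <= e * s ^+ 2.

Lemma near0_le (r : R) : 0 < r -> \forall s \near (0 : R), `|s| <= r.
Proof.
by move=> r0; apply/nbhs_ballP; exists r => //= s; rewrite /ball /= sub0r normrN => /ltW.
Qed.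

Lemma jet2_eq g a b c a' b' c' :
  a = a' -> b = b' -> c = c' -> jet2 g a b c -> jet2 g a' b' c'.
Proof. by move=> -> -> ->. Qed.

Lemma jet2_near g h a b c :
  (\forall s \near (0 : R), g s = h s) -> jet2 g a b c -> jet2 h a b c.
Proof.
move=> gh jg e e0; near=> s; have <- : g s = h s by near: s.
by near: s; exact: jg.
Unshelve. all: by end_near. Qed.

Lemma jet2_quad a b c : jet2 (fun s => a + b * s + c * s ^+ 2) a b c.
Proof.
by move=> e e0; near=> s; rewrite subrr normr0 mulr_ge0 ?sqr_ge0// ltW.
Unshelve. all: by end_near. Qed.

Lemma jet2_cst a : jet2 (fun=> a) a 0 0.
Proof.
apply: jet2_near (jet2_quad a 0 0); near=> s; by rewrite !mul0r !addr0.
Unshelve. all: by end_near. Qed.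

Lemma jet2_affine a b : jet2 (fun s => a + s * b) a b 0.
Proof.
apply: jet2_near (jet2_quad a b 0); near=> s; by rewrite !mul0r addr0 mulrC.
Unshelve. all: by end_near. Qed.

Lemma jet2D g h a b c a' b' c' : jet2 g a b c -> jet2 h a' b' c' ->
  jet2 (fun s => g s + h s) (a + a') (b + b') (c + c').
Proof.
move=> jg jh e e0; have e20 : 0 < e / 2 by lra.
near=> s.
have H1 : `|g s - (a + b * s + c * s ^+ 2)| <= e / 2 * s ^+ 2 by near: s; exact: jg.
have H2 : `|h s - (a' + b' * s + c' * s ^+ 2)| <= e / 2 * s ^+ 2 by near: s; exact: jh.
have -> : g s + h s - (a + a' + (b + b') * s + (c + c') * s ^+ 2) =
  (g s - (a + b * s + c * s ^+ 2)) + (h s - (a' + b' * s + c' * s ^+ 2)) by ring.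
apply: le_trans (ler_normD _ _) _; lra.
Unshelve. all: by end_near. Qed.

Lemma jet2M g h a b c a' b' c' : jet2 g a b c -> jet2 h a' b' c' ->
  jet2 (fun s => g s * h s) (a * a') (a * b' + b * a')
    (a * c' + b * b' + c * a').
Proof.
move=> jg jh e e0.
pose M := `|a| + `|b| + `|c| + `|a'| + `|b'| + `|c'| + 1.
have M1 : 1 <= M by rewrite /M ler_wpDl// !addr_ge0.
have M0 : 0 < M by lra.
(* The two remainders cost at most 3 M d s^2 and the terms of degree 3 and 4 at most 3 M^2 d s^2,
   once |s| <= d. As M >= 1, the total is at most 6 M^2 d s^2 <= e s^2. *)
pose d := e / (8 * M ^+ 2).
have d0 : 0 < d by rewrite divr_gt0// mulr_gt0// exprn_gt0.
have dM : 8 * M * d <= e.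
  have -> : e = 8 * M ^+ 2 * d by rewrite /d mulrC divfK// gt_eqF// mulr_gt0// exprn_gt0.
  by rewrite ler_wpM2r ?(ltW d0)// ler_wpM2l// expr2 ler_peMr// ltW.
near=> s.
have s1 : `|s| <= 1 by near: s; exact: near0_le.
have sd : `|s| <= d by near: s; exact: near0_le.
have H1 : `|g s - (a + b * s + c * s ^+ 2)| <= d * s ^+ 2 by near: s; exact: jg.
have H1' : `|g s - (a + b * s + c * s ^+ 2)| <= 1 * s ^+ 2 by near: s; exact: jg.
have H2 : `|h s - (a' + b' * s + c' * s ^+ 2)| <= d * s ^+ 2 by near: s; exact: jh.
set u := g s - _ in H1 H1'; set v := h s - _ in H2.
set j := a + b * s + c * s ^+ 2 in u H1 H1'; set j' := a' + b' * s + c' * s ^+ 2 in v H2.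
have -> : g s * h s - (a * a' + (a * b' + b * a') * s + (a * c' + b * b' + c * a') * s ^+ 2)
  = u * v + u * j' + j * v + s * s ^+ 2 * (b * c' + c * b' + c * c' * s).
  rewrite /u /v /j /j'; ring.
have s2 : 0 <= s ^+ 2 by exact: sqr_ge0.
have s21 : s ^+ 2 <= 1 by rewrite -(real_normK (num_real s)) exprn_ile1.
have bj (x y z : R) : `|x| + `|y| + `|z| <= M -> `|x + y * s + z * s ^+ 2| <= M.
  move=> H; apply: le_trans (ler_normD _ _) _; apply: le_trans (lerD (ler_normD _ _) (lexx _)) _.
  rewrite (normrM y) (normrM z) normrX; apply: le_trans H; apply: lerD; first apply: lerD => //.
    by rewrite ler_piMr.
  by rewrite ler_piMr// exprn_ile1.
have [a0 b0 c0] := And3 (normr_ge0 a) (normr_ge0 b) (normr_ge0 c).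
have [a'0 b'0 c'0] := And3 (normr_ge0 a') (normr_ge0 b') (normr_ge0 c').
have Mj : `|j| <= M by apply: bj; rewrite /M; lra.
have Mj' : `|j'| <= M by apply: bj; rewrite /M; lra.
have Mb : `|b| <= M by rewrite /M; lra.
have Mc : `|c| <= M by rewrite /M; lra.
have Mb' : `|b'| <= M by rewrite /M; lra.
have Mc' : `|c'| <= M by rewrite /M; lra.
have uv : `|u * v| <= M * d * s ^+ 2.
  rewrite normrM; apply: (@le_trans _ _ (1 * (d * s ^+ 2))).
    by rewrite ler_pM// (le_trans H1')// mul1r.
  by rewrite mul1r -mulrA ler_peMl// mulr_ge0// ltW.
have uj : `|u * j'| <= M * d * s ^+ 2 by rewrite normrM mulrC -mulrA ler_pM.
have jv : `|j * v| <= M * d * s ^+ 2 by rewrite normrM -mulrA ler_pM.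
have last_ : `|s * s ^+ 2 * (b * c' + c * b' + c * c' * s)| <= 3 * M ^+ 2 * d * s ^+ 2.
  rewrite (normrM (s * s ^+ 2)) (normrM s) (ger0_norm s2) -mulrA.
  have H : `|b * c' + c * b' + c * c' * s| <= 3 * M ^+ 2.
    apply: le_trans (ler_normD _ _) _; apply: le_trans (lerD (ler_normD _ _) (lexx _)) _.
    have -> : 3 * M ^+ 2 = M * M + M * M + M * M by ring.
    rewrite !normrM; apply: lerD; first by rewrite lerD// ler_pM.
    by apply: le_trans (ler_piMr _ s1) _; rewrite ?mulr_ge0// ler_pM.
  have -> : 3 * M ^+ 2 * d * s ^+ 2 = d * (s ^+ 2 * (3 * M ^+ 2)) by ring.
  by apply: ler_pM => //; [exact: mulr_ge0 | exact: ler_wpM2l].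
have dM' : M ^+ 2 * d = e / 8.
  rewrite /d; field; exact: lt0r_neq0.
have : 3 * M * d + 3 * M ^+ 2 * d <= e by lra.
move=> /(ler_wpM2r s2) De.
apply: le_trans (ler_normD _ _) _; apply: le_trans (lerD (ler_normD _ _) (lexx _)) _.
apply: le_trans (lerD (lerD (ler_normD _ _) (lexx _)) (lexx _)) _.
apply: le_trans De.
have -> : (3 * M * d + 3 * M ^+ 2 * d) * s ^+ 2 =
  M * d * s ^+ 2 + M * d * s ^+ 2 + M * d * s ^+ 2 + 3 * M ^+ 2 * d * s ^+ 2 by ring.
exact: lerD (lerD (lerD uv uj) jv) last_.
Unshelve. all: by end_near. Qed.

Lemma jet2Z k g a b c : jet2 g a b c -> jet2 (fun s => k * g s) (k * a) (k * b) (k * c).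
Proof. by move=> /(jet2M (jet2_cst k)); apply: jet2_eq; ring. Qed.

Lemma jet2N g a b c : jet2 g a b c -> jet2 (fun s => - g s) (- a) (- b) (- c).
Proof.
move=> /(jet2Z (-1)) /jet2_near; rewrite !mulN1r; apply; near=> s; by rewrite mulN1r.
Unshelve. all: by end_near. Qed.

Lemma jet2_sum (I : Type) (r : seq I) (P : pred I) (g : I -> R -> R) (a b c : I -> R) :
  (forall i, jet2 (g i) (a i) (b i) (c i)) ->
  jet2 (fun s => \sum_(i <- r | P i) g i s) (\sum_(i <- r | P i) a i)
    (\sum_(i <- r | P i) b i) (\sum_(i <- r | P i) c i).
Proof.
move=> jg; elim: r => [|i r IH].
  rewrite !big_nil; apply: jet2_near (jet2_cst 0); near=> s; by rewrite big_nil.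
rewrite !big_cons; case: ifP => Pi.
  apply: jet2_near (jet2D (jg i) IH); near=> s; by rewrite big_cons Pi.
apply: jet2_near IH; near=> s; by rewrite big_cons Pi.
Unshelve. all: by end_near. Qed.

Lemma jet2X k g a b c : jet2 g a b c ->
  jet2 (fun s => g s ^+ k.+2) (a ^+ k.+2) (k.+2%:R * a ^+ k.+1 * b)
    (k.+2%:R * a ^+ k.+1 * c + k.+2%:R * k.+1%:R / 2 * a ^+ k * b ^+ 2).
Proof.
move=> jg; elim: k => [|k IH].
  by apply: jet2_eq (jet2M jg jg); rewrite ?expr2 ?expr1 ?expr0; field.
have := jet2M jg IH => /jet2_near H.
have : jet2 (fun s => g s ^+ k.+3) (a * a ^+ k.+2)
   (a * (k.+2%:R * a ^+ k.+1 * b) + b * a ^+ k.+2)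
   (a * (k.+2%:R * a ^+ k.+1 * c + k.+2%:R * k.+1%:R / 2 * a ^+ k * b ^+ 2) + b * (k.+2%:R * a ^+ k.+1 * b) + c * a ^+ k.+2).
  by apply: H; near=> s; rewrite [RHS]exprS.
apply: jet2_eq; rewrite -?natr1 ?exprS; field.
Unshelve. all: by end_near. Qed.

(** First and second order conditions at an interior minimum of value 0. Every consequence of
    touching or of the positivity of W at nearby points is drawn through this lemma. *)
Lemma jet2_ge0 g b c : (\forall s \near (0 : R), 0 <= g s) -> jet2 g 0 b c ->
  b = 0 /\ 0 <= c.
Proof.
move=> g0 jg.
have b0 : b = 0.
  have : \forall s \near (0:R), 0 <= g s /\ `|g s - (0 + b * s + c * s ^+ 2)| <= 1 * s ^+ 2.
    by near=> s; split; near: s => //; exact: jg.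
  move=> /nbhs_ballP[r /= r0 rP].
  (* Nonnegativity at s bounds b from below and at - s from above; the 1 is the remainder constant
     chosen above. *)
  have key s : 0 < s -> s < r -> `|b| <= (c + 1) * s.
    move=> s0 sr.
    have [|h1 /ler_normlP[_ h2]] := rP s; first by rewrite /ball /= sub0r normrN gtr0_norm.
    have [|h3 /ler_normlP[_ h4]] := rP (- s); first by rewrite /ball /= sub0r opprK gtr0_norm.
    have k1 : 0 <= s * (b + (c + 1) * s).
      by rewrite (_ : s * _ = b * s + c * s ^+ 2 + s ^+ 2); [lra | ring].
    have k2 : 0 <= s * (- b + (c + 1) * s).
      rewrite (_ : s * _ = b * - s + c * (- s) ^+ 2 + (- s) ^+ 2); [lra | ring].
    move: k1 k2; rewrite !pmulr_rge0// => k1 k2.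
    by rewrite ler_norml; lra.
  apply/eqP/negPn/negP => bn0.
  have bn : 0 < `|b| by rewrite normr_gt0.
  have r2 : 0 < r / 2 by rewrite divr_gt0.
  have c1 : 0 < c + 1.
    have : 0 < (c + 1) * (r / 2) by apply: lt_le_trans bn _; apply: key => //; lra.
    by rewrite pmulr_lgt0.
  pose s := Num.min (r / 2) (`|b| / (2 * (c + 1))).
  have s0 : 0 < s by rewrite lt_min r2 divr_gt0// mulr_gt0.
  have sr : s < r by rewrite /s gt_min; apply/orP; left; lra.
  have sb : s <= `|b| / (2 * (c + 1)) by rewrite /s ge_min lexx orbT.
  have := key s s0 sr; have := ler_wpM2l (ltW c1) sb.
  have -> : (c + 1) * (`|b| / (2 * (c + 1))) = `|b| / 2 by field; exact: lt0r_neq0.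
  lra.
split=> //; rewrite leNgt; apply/negP => c0.
have e0 : 0 < - c / 2 by lra.
have : \forall s \near (0:R), 0 <= g s /\ `|g s - (0 + b * s + c * s ^+ 2)| <= - c / 2 * s ^+ 2.
  by near=> s; split; near: s => //; exact: jg.
move=> /nbhs_ballP[r /= r0 rP].
have [|h1 h2] := rP (r / 2); first by rewrite /ball /= sub0r normrN gtr0_norm; lra.
move: h2; rewrite b0 mul0r !add0r => /ler_normlP[_].
have : 0 < (r / 2) ^+ 2 by rewrite exprn_gt0// divr_gt0.
set x := (r / 2) ^+ 2 => x0 h2.
have : c * x < 0 by rewrite pmulr_llt0. lra.
Unshelve. all: by end_near. Qed.

Lemma jet2_eq0 g b c : (\forall s \near (0 : R), g s = 0) -> jet2 g 0 b c ->
  b = 0 /\ c = 0.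
Proof.
move=> g0 jg.
have [-> c0] : b = 0 /\ 0 <= c.
  by apply: jet2_ge0 jg; apply: filterS g0 => s ->.
have := jet2N jg; rewrite oppr0 => /jet2_ge0[].
  by apply: filterS g0 => s ->; rewrite oppr0.
by move=> _ c1; split => //; lra.
Qed.

End Jets.

(** * Positive semidefinite forms *)

Section Bilinear.
Variables (R : realType) (n : nat).
Implicit Types (A B W : 'M[R]_n) (x y z : 'rV[R]_n).

Definition bil A x y : R := (x *m A *m y^T) 0 0.
Definition dot x y : R := bil 1%:M x y.

Lemma bilE A x y : bil A x y = \sum_i \sum_j A i j * (x 0 i * y 0 j).
Proof.
rewrite /bil mxE exchange_big /=; apply: eq_bigr => j _.
rewrite mxE mulr_suml; apply: eq_bigr => i _; rewrite !mxE; ring.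
Qed.

Lemma dotE x y : dot x y = \sum_i x 0 i * y 0 i.
Proof. by rewrite /dot /bil mulmx1 mxE; apply: eq_bigr => i _; rewrite mxE. Qed.

Lemma bilDl A x x' y : bil A (x + x') y = bil A x y + bil A x' y.
Proof. by rewrite /bil !mulmxDl mxE. Qed.
Lemma bilDr A x y y' : bil A x (y + y') = bil A x y + bil A x y'.
Proof. by rewrite /bil raddfD /= mulmxDr mxE. Qed.
Lemma bilZl A k x y : bil A (k *: x) y = k * bil A x y.
Proof. by rewrite /bil -!scalemxAl mxE. Qed.
Lemma bilZr A k x y : bil A x (k *: y) = k * bil A x y.
Proof. by rewrite /bil linearZ /= -scalemxAr mxE. Qed.
Lemma bilNl A x y : bil A (- x) y = - bil A x y.
Proof. by rewrite -scaleN1r bilZl mulN1r. Qed.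
Lemma bilNr A x y : bil A x (- y) = - bil A x y.
Proof. by rewrite -scaleN1r bilZr mulN1r. Qed.
Lemma bil0l A y : bil A 0 y = 0.
Proof. by rewrite /bil !mul0mx mxE. Qed.
Lemma bil0r A y : bil A y 0 = 0.
Proof. by rewrite /bil trmx0 mulmx0 mxE. Qed.
Lemma bilDm A B x y : bil (A + B) x y = bil A x y + bil B x y.
Proof. by rewrite /bil mulmxDr mulmxDl mxE. Qed.
Lemma bilZm k A x y : bil (k *: A) x y = k * bil A x y.
Proof. by rewrite /bil -scalemxAr -scalemxAl mxE. Qed.
Lemma bilNm A x y : bil (- A) x y = - bil A x y.
Proof. by rewrite -scaleN1r bilZm mulN1r. Qed.
Lemma bil_scalar k x y : bil k%:M x y = k * dot x y.
Proof. by rewrite -scalemx1 bilZm. Qed.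
Lemma bilC A x y : A^T = A -> bil A x y = bil A y x.
Proof.
move=> sA; have : (x *m A *m y^T)^T = y *m A *m x^T.
  by rewrite !trmx_mul trmxK sA mulmxA.
by rewrite /bil => <-; rewrite [RHS]mxE.
Qed.
Lemma dotC x y : dot x y = dot y x.
Proof. by apply: bilC; rewrite trmx1. Qed.

Definition bilL := (bilDl, bilDr, bilZl, bilZr, bilNl, bilNr).

Lemma dotDl x x' y : dot (x + x') y = dot x y + dot x' y.
Proof. exact: bilDl. Qed.
Lemma dotDr x y y' : dot x (y + y') = dot x y + dot x y'.
Proof. exact: bilDr. Qed.
Lemma dotZl k x y : dot (k *: x) y = k * dot x y.
Proof. exact: bilZl. Qed.
Lemma dotZr k x y : dot x (k *: y) = k * dot x y.
Proof. exact: bilZr. Qed.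
Lemma dotNl x y : dot (- x) y = - dot x y.
Proof. exact: bilNl. Qed.
Lemma dotNr x y : dot x (- y) = - dot x y.
Proof. exact: bilNr. Qed.

Definition dotL := (dotDl, dotDr, dotZl, dotZr, dotNl, dotNr).

Lemma bil_delta A i j : bil A (delta_mx 0 i) (delta_mx 0 j) = A i j.
Proof. by rewrite /bil -rowE trmx_delta -colE !mxE. Qed.
Lemma dot_delta x i : dot x (delta_mx 0 i) = x 0 i.
Proof.
by rewrite /dot /bil mulmx1 trmx_delta -colE mxE.
Qed.

Lemma row_sum x : x = \sum_i x 0 i *: delta_mx 0 i.
Proof. exact: row_sum_delta. Qed.

Lemma bil_suml A (k : 'I_n -> R) y :
  \sum_i k i * bil A (delta_mx 0 i) y = bil A (\row_i k i) y.
Proof.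
rewrite [in RHS](row_sum (\row_i k i)) /bil !mulmx_suml summxE.
by apply: eq_bigr => i _; rewrite [(\row_j k j) 0 i]mxE -!scalemxAl [RHS]mxE.
Qed.

Lemma dot_ge0 x : 0 <= dot x x.
Proof. by rewrite dotE sumr_ge0// => i _; rewrite -expr2 sqr_ge0. Qed.

Lemma dot_eq0 x : (dot x x == 0) = (x == 0).
Proof.
rewrite dotE psumr_eq0; last by move=> i _; rewrite -expr2 sqr_ge0.
apply/idP/eqP => [/allP H|->]; last by apply/allP => i _; rewrite /= mxE mul0r eqxx.
apply/rowP => i; rewrite mxE; have := H i (mem_index_enum _).
by rewrite mulf_eq0 orbb => /eqP.
Qed.

Lemma dot_gt0 x : x != 0 -> 0 < dot x x.
Proof. by move=> x0; rewrite lt_neqAle dot_ge0 eq_sym dot_eq0 x0. Qed.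

Lemma trace_bil A : \tr A = \sum_i bil A (delta_mx 0 i) (delta_mx 0 i).
Proof. by apply: eq_bigr => i _; rewrite bil_delta. Qed.

Lemma dotZZ k x : dot (k *: x) (k *: x) = k ^+ 2 * dot x x.
Proof. rewrite /dot !bilL; ring. Qed.

Lemma bil_ge_unit A k : (forall x, dot x x = 1 -> k <= bil A x x) ->
  forall x, k * dot x x <= bil A x x.
Proof.
move=> H x; have [->|x0] := eqVneq x 0; first by rewrite /dot !bil0l mulr0.
have d0 := dot_gt0 x0; pose r := (Num.sqrt (dot x x))^-1.
have r2 : r ^+ 2 = (dot x x)^-1 by rewrite /r exprVn sqr_sqrtr// ltW.
have := H (r *: x); rewrite dotZZ r2 mulVf ?gt_eqF// => /(_ erefl).
by rewrite bilZl bilZr mulrA -expr2 r2 mulrC ler_pdivlMr.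
Qed.

Lemma quad_ge0_lin0 (b c : R) : (forall s, 0 <= 2 * s * b + s ^+ 2 * c) -> b = 0.
Proof.
move=> H; have c2 : 0 <= c by have := H 1; have := H (-1); lra.
apply/eqP; rewrite -sqrf_eq0 eq_le sqr_ge0 andbT.
have c1 : 0 < c + 1 by rewrite ltr_wpDl.
(* The minimizer - b / c, with c + 1 in place of c to cover c = 0. *)
have := H (- b / (c + 1)).
have -> : 2 * (- b / (c + 1)) * b + (- b / (c + 1)) ^+ 2 * c = - (b ^+ 2 * (c + 2) / (c + 1) ^+ 2).
  by field; exact: lt0r_neq0.
have q : 0 < (c + 2) / (c + 1) ^+ 2 by rewrite divr_gt0 ?exprn_gt0// ltr_wpDl.
by rewrite oppr_ge0 -mulrA pmulr_lle0.
Qed.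

Lemma psd_null_bil A x y : A^T = A -> psd A -> bil A x x = 0 -> bil A x y = 0.
Proof.
move=> sA pA xx; apply: (@quad_ge0_lin0 _ (bil A y y)) => s.
have := pA (x + s *: y); rewrite -/(bil _ _ _) !bilL xx [bil A y x]bilC//.
by congr (_ <= _); ring.
Qed.

(* d^-1 Q is an orthogonal projection, so d tr (W Q) = tr (Q W Q). *)
Lemma psd_trace_sqr W (Q : 'M[R]_n) d : psd W -> Q^T = Q -> Q *m Q = d *: Q ->
  0 <= d * \tr (W *m Q).
Proof.
move=> pW sQ QQ; rewrite -mxtraceZ scalemxAr -QQ mulmxA mxtrace_mulC mulmxA.
rewrite trace_bil sumr_ge0// => i _.
rewrite /bil !mulmxA -(mulmxA _ Q) -{2}sQ -mulmxA.
by rewrite -trmx_mul mulmxA; exact: pW.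
Qed.

Lemma trmul_row (x y : 'rV[R]_n) A : \tr (A *m (x^T *m y)) = bil A y x.
Proof.
rewrite mulmxA mxtrace_mulC mulmxA /bil.
by rewrite /mxtrace big_ord1.
Qed.

Lemma row_trmul x y : x *m y^T = (dot x y)%:M.
Proof. by apply/matrixP => i j; rewrite /dot /bil mulmx1 !ord1 [RHS]mxE mulr1n. Qed.

Lemma rank1_mul (x y z t : 'rV[R]_n) : (x^T *m y) *m (z^T *m t) = dot y z *: (x^T *m t).
Proof.
by rewrite -mulmxA (mulmxA y) row_trmul mul_scalar_mx -scalemxAr.
Qed.

Lemma psd_le_trace W x : psd W -> bil W x x <= \tr W * dot x x.
Proof.
move=> pW; have [->|x0] := eqVneq x 0; first by rewrite /dot !bil0l mulr0.
have d0 := dot_gt0 x0.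
(* |x|^2 times the orthogonal projection onto the complement of x. *)
pose Q := dot x x *: 1%:M - x^T *m x.
have sQ : Q^T = Q by rewrite /Q linearB linearZ /= trmx1 trmx_mul trmxK.
have QQ : Q *m Q = dot x x *: Q.
  rewrite {1 2}/Q mulmxBl !mulmxBr rank1_mul -!scalemxAl -!scalemxAr !mul1mx mulmx1.
  by rewrite subrr subr0 scalerBr.
have := psd_trace_sqr pW sQ QQ; rewrite pmulr_rge0//.
by rewrite mulmxBr raddfB /= trmul_row -scalemxAr mulmx1 mxtraceZ subr_ge0 mulrC.
Qed.

(* With d = |x|^2 |y|^2 - (x . y)^2, the difference of the two sides is
   tr (W Q), where d^-1 Q is the projection orthogonal to x and y. *)
Lemma psd_le_trace2 W x y : W^T = W -> psd W ->
  dot x x * bil W y y - 2 * dot x y * bil W x y + dot y y * bil W x x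
  <= \tr W * (dot x x * dot y y - dot x y ^+ 2).
Proof.
move=> sW pW.
pose d := dot x x * dot y y - dot x y ^+ 2.
have [->|x0] := eqVneq x 0; first by rewrite /dot !bil0l expr0n /=; lra.
have dx := dot_gt0 x0.
pose z := y - (dot x y / dot x x) *: x.
have zz : dot x x * dot z z = d.
  rewrite /z /d /dot !bilL -!/(dot _ _) (dotC y x); field; exact: lt0r_neq0.
(* The coefficients are the adjugate of the Gram matrix of x and y, so S is d times the orthogonal
   projection onto their span when d is nonzero. *)
pose S := dot x x *: (y^T *m y) - dot x y *: (y^T *m x) - dot x y *: (x^T *m y) + dot y y *: (x^T *m x).
pose Q := d *: 1%:M - S.
have trQ : \tr (W *m Q) = \tr W * d - (dot x x * bil W y y - 2 * dot x y * bil W x y + dot y y * bil W x x).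
  rewrite /Q /S !(mulmxBr, mulmxDr) -!scalemxAr mulmx1 raddfB /= raddfD /= !raddfB /= !mxtraceZ !trmul_row.
  rewrite (bilC y x sW); ring.
(* For d = 0 the vectors are parallel and both sides vanish. *)
have [d0|d0] := eqVneq d 0.
  have z0 : z = 0.
    by apply/eqP; rewrite -dot_eq0; move/eqP: zz; rewrite d0 mulf_eq0 gt_eqF.
  have yE : y = (dot x y / dot x x) *: x by apply/eqP; rewrite -subr_eq0 -/z z0.
  rewrite -/d d0 mulr0 yE /dot !bilL -!/(dot _ _).
  rewrite le_eqVlt; apply/orP; left; apply/eqP; field; exact: lt0r_neq0.
have dp : 0 < d by rewrite lt_neqAle eq_sym d0 -zz mulr_ge0// dot_ge0.
have sQ : Q^T = Q.
  rewrite /Q /S linearB linearZ /= linearD /= linearB /= linearB /= !linearZ /= trmx1 !trmx_mul !trmxK.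
  by rewrite (addrAC (dot x x *: _)).
have QQ : Q *m Q = d *: Q.
  have SS : S *m S = d *: S.
    rewrite /S !(mulmxBl, mulmxDl, mulmxBr, mulmxDr) -!scalemxAl -!scalemxAr !rank1_mul !scalerA.
    rewrite (dotC y x).
    rewrite !scalerDr !scalerN !scalerA /d.
    set a := dot x x; set b := dot x y; set c := dot y y.
    apply/matrixP => i j; rewrite !mxE; ring.
  rewrite {1 2}/Q mulmxBl !mulmxBr SS -!scalemxAl -!scalemxAr !mul1mx mulmx1.
  by rewrite subrr subr0 scalerBr.
have := psd_trace_sqr pW sQ QQ; rewrite pmulr_rge0// trQ subr_ge0; exact.
Qed.

End Bilinear.

(** * The algebraic inequality *)

Section KeyInequality.
Variables (R : realType) (n : nat).
Implicit Types (A W : 'M[R]_n) (x y b g : 'rV[R]_n).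

Lemma bil_sum_row A x y : \sum_i x 0 i * bil A (delta_mx 0 i) y = bil A x y.
Proof. by rewrite bil_suml; congr bil; apply/rowP => i; rewrite mxE. Qed.

Lemma dot_sum_row x y : \sum_i x 0 i * y 0 i = dot x y.
Proof. by rewrite dotE. Qed.

(* The multipliers for the directions d_t and T e_j - g_j d_t, obtained by
   dualizing the inequality in the third derivatives of u. *)
Definition eta_t (s : R) b : 'rV[R]_n := - s^-1 *: b.
Definition eta_x (T s tau : R) b g (j : 'I_n) : 'rV[R]_n :=
  - (T * tau - s^-1 * dot b g) *: delta_mx 0 j
  + s^-1 *: (g 0 j *: b - b 0 j *: g).

(** The part g_j b - b_j g of [eta_x] is antisymmetric in b and g, so it drops out against the
    symmetric A, which enters only through its trace. The gap between the two sides is then eps s^-2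
    times the gap of [psd_le_trace] at b plus s^-2 times the gap of [psd_le_trace2] at g, b. The
    right-hand side is minus T / 2 times that of the twice differentiated equation. *)
Lemma key_inequality (W A : 'M[R]_n) (T s eps tau : R) b g :
  W^T = W -> psd W -> A^T = A -> \tr W = s -> 0 < s -> 0 < eps ->
  T * s = eps + dot g g -> \tr A = s * tau ->
  \sum_j (2 * (T * bil A (delta_mx 0 j) (eta_x T s tau b g j)
                 - g 0 j * dot b (eta_x T s tau b g j))
          + bil W (eta_x T s tau b g j) (eta_x T s tau b g j))
  + eps * (2 * dot b (eta_t s b) + bil W (eta_t s b) (eta_t s b))
  <= - (T * (dot (b - tau *: g) (b - tau *: g) + eps * tau ^+ 2)).
Proof.
move=> sW pW sA tW s0 e0 TE trA; rewrite /eta_t.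
have sn := lt0r_neq0 s0.
pose k := T * tau - s^-1 * dot b g.
set eta := eta_x T s tau b g.
have E1 : \sum_j bil A (delta_mx 0 j) (eta j) = - k * (s * tau).
  under eq_bigr => j _.
    have -> : bil A (delta_mx 0 j) (eta j) = - k * A j j + s^-1 * (g 0 j * bil A (delta_mx 0 j) b) - s^-1 * (b 0 j * bil A (delta_mx 0 j) g).
      by rewrite /eta /eta_x -/k !bilL bil_delta; ring.
    over.
  rewrite sumrB big_split /= -!mulr_sumr !bil_sum_row (bilC g b sA) -trA.
  by rewrite addrK.
have E2 : \sum_j g 0 j * dot b (eta j) = - k * dot b g + s^-1 * (dot g g * dot b b - dot b g ^+ 2).
  under eq_bigr => j _.
    have -> : g 0 j * dot b (eta j) = - k * (b 0 j * g 0 j) + s^-1 * dot b b * (g 0 j * g 0 j) - s^-1 * dot b g * (b 0 j * g 0 j).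
      by rewrite /eta /eta_x -/k /dot !bilL -!/(dot _ _) dot_delta; ring.
    over.
  by rewrite sumrB big_split /= -!mulr_sumr !dot_sum_row; ring.
have E3 : \sum_j bil W (eta j) (eta j) = k ^+ 2 * s + s^-1 ^+ 2 *
    (dot g g * bil W b b - 2 * dot g b * bil W g b + dot b b * bil W g g).
  under eq_bigr => j _.
    have -> : bil W (eta j) (eta j) = k ^+ 2 * W j j
      + (- 2 * k * s^-1) * (g 0 j * bil W (delta_mx 0 j) b)
      + (2 * k * s^-1) * (b 0 j * bil W (delta_mx 0 j) g)
      + s^-1 ^+ 2 * bil W b b * (g 0 j * g 0 j)
      + (- 2 * s^-1 ^+ 2 * bil W g b) * (g 0 j * b 0 j)
      + s^-1 ^+ 2 * bil W g g * (b 0 j * b 0 j).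
      rewrite /eta /eta_x -/k !bilL bil_delta (bilC b g sW) (bilC b _ sW) (bilC g (delta_mx 0 j) sW).
      ring.
    over.
  rewrite !big_split /= -!mulr_sumr !bil_sum_row !dot_sum_row (bilC g b sW).
  rewrite (_ : \sum_i W i i = s) //; ring.
rewrite big_split /= E3 -mulr_sumr sumrB -mulr_sumr E1 E2.
rewrite {E1 E2 E3}/dot !bilL -!/(dot _ _).
have H1 := psd_le_trace b pW; rewrite tW in H1.
have H2 := psd_le_trace2 g b sW pW; rewrite tW in H2.
have T0 : T = (eps + dot g g) / s by rewrite -TE mulfK.
rewrite (dotC g b) in H2 *.
rewrite /k; clear k.
set bb := dot b b in H1 H2 *; set gg := dot g g in T0 H2 *; set bg := dot b g in H2 *.
set Wbb := bil W b b in H1 H2 *; set Wgb := bil W g b in H2 *; set Wgg := bil W g g in H2 *.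
set r := s^-1 in T0 *.
have r0 : 0 < r by rewrite invr_gt0.
have sr : s * r = 1 by rewrite mulfV.
rewrite -subr_ge0.
have key Z : Z = eps * r ^+ 2 * (s * bb - Wbb) + r ^+ 2 * (s * (gg * bb - bg ^+ 2) - (gg * Wbb - 2 * bg * Wgb + bb * Wgg)) -> 0 <= Z.
  move=> ->; apply: addr_ge0; apply: mulr_ge0; rewrite ?subr_ge0 ?sqr_ge0//.
  by rewrite mulr_ge0 ?sqr_ge0 ?ltW.
apply: key.
by rewrite T0 /r; field.
Qed.

End KeyInequality.

(** * Directional derivatives *)

Lemma cvg_is_derive (R : realType) (V : normedModType R) (f : V -> R) (p h : V) (d : R) :
  (s^-1 *: (f (s *: h + p) - f p)) @[s --> (0 : R)^'] --> d -> is_derive p h f d.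
Proof.
move=> H; have H' : s^-1 *: ((f \o shift p) (s *: h) - f p) @[s --> (0 : R)^'] --> d by [].
by split; [apply/cvg_ex; exists d | exact: cvg_lim].
Qed.

Lemma is_derive_cvg (R : realType) (V : normedModType R) (f : V -> R) (p h : V) (d : R) : is_derive p h f d ->
  (s^-1 *: (f (s *: h + p) - f p)) @[s --> (0 : R)^'] --> d.
Proof. by case=> H <-. Qed.

Section DirectionalDerivatives.
Variables (R : realType) (V : normedModType R).
Implicit Types (f g : V -> R) (p q h k : V) (U : set V).

Lemma is_derive_line f p h (s d : R) : is_derive (p + s *: h) h f d ->
  is_derive s 1 (fun t : R => f (p + t *: h)) d.
Proof.
move=> /is_derive_cvg H; apply: cvg_is_derive.
rewrite (_ : (fun _ => _) = (fun t => t^-1 *: (f (t *: h + (p + s *: h)) - f (p + s *: h)))) //.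
by apply/funext => t; rewrite [t *: 1]mulr1 scalerDl addrCA.
Qed.

Lemma is_derive_shift f p h k (d : R) : is_derive (p + k) h f d ->
  is_derive p h (fun q => f (q + k)) d.
Proof.
move=> /is_derive_cvg H; apply: cvg_is_derive.
rewrite (_ : (fun _ => _) = (fun t => t^-1 *: (f (t *: h + (p + k)) - f (p + k)))) //.
by apply/funext => t; rewrite addrA.
Qed.

Lemma MVT_line f (f1 : R -> R) p h (s : R) :
  (forall t, `|t| <= `|s| -> is_derive (p + t *: h) h f (f1 t)) ->
  exists2 c, `|c| <= `|s| & f (p + s *: h) - f p = f1 c * s.
Proof.
move=> df.
have dg (t : R) : `|t| <= `|s| ->
    is_derive t 1 (fun t : R => f (p + t *: h)) (f1 t).
  by move=> /df dft; exact: is_derive_line.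
have cg (t : R) : `|t| <= `|s| -> {for t, continuous (fun t : R => f (p + t *: h))}.
  by move=> /dg [/derivable1_diffP/differentiable_continuous + _].
have [s0|s0|->] := ltgtP s 0; last 1 first.
- by exists 0; rewrite ?normr0// scale0r addr0 subrr mulr0.
- have [x||c] := @MVT R (fun t : R => f (p + t *: h)) f1 s 0 s0.
  + rewrite in_itv /= => /andP[x1 x2]; apply: dg; rewrite (ltr0_norm s0) (ltr0_norm x2); lra.
  + apply: continuous_in_subspaceT => x; rewrite inE /= in_itv /= => /andP[x1 x2].
    by apply: cg; rewrite (ltr0_norm s0) ler0_norm//; lra.
  + rewrite in_itv /= => /andP[c1 c2] E; exists c; first by rewrite (ltr0_norm s0) (ltr0_norm c2); lra.
    move: E; rewrite scale0r addr0 sub0r => E.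
    by apply: oppr_inj; rewrite opprB E mulrN.
- have [x||c] := @MVT R (fun t : R => f (p + t *: h)) f1 0 s s0.
  + rewrite in_itv /= => /andP[x1 x2]; apply: dg; rewrite !gtr0_norm//; lra.
  + apply: continuous_in_subspaceT => x; rewrite inE /= in_itv /= => /andP[x1 x2].
    by apply: cg; rewrite (gtr0_norm s0) ger0_norm.
  + rewrite in_itv /= => /andP[c1 c2] E; exists c; first by rewrite !gtr0_norm//; lra.
    by move: E; rewrite scale0r addr0 subr0.
Qed.

Lemma nbhs_norm_ball p (A : set V) : nbhs p A ->
  exists2 r : R, 0 < r & forall q, `|q| < r -> A (p + q).
Proof.
move=> /nbhs_ballP[r /= r0 rA]; exists r => // q qr; apply: rA.
by rewrite -ball_normE /= opprD addrA subrr sub0r normrN.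
Qed.

(** Smoothness is given along the axes only; this adds one axis at a time to a direction. The
    increment is split into a step along k, governed by the derivative at p, and a step along h from
    p + s k, where the mean value theorem and the continuity of [f1] apply. *)
Lemma is_derive_addZ f (f1 : V -> R) p h k (c d : R) :
  (\forall q \near p, is_derive q h f (f1 q)) -> {for p, continuous f1} ->
  is_derive p k f d -> is_derive p (c *: h + k) f (c * f1 p + d).
Proof.
move=> dh ch /is_derive_cvg dk; apply: cvg_is_derive; apply/cvgrPdist_le => e e0.
have e20 : 0 < e / 2 by rewrite divr_gt0.
pose e' := e / 2 / (`|c| + 1).
have c1 : 0 < `|c| + 1 by rewrite ltr_wpDl.
have e'0 : 0 < e' by rewrite divr_gt0.
have ch' : \forall q \near p, `|f1 p - f1 q| <= e'.
  by move/cvgrPdist_le : ch => /(_ _ e'0).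
have [r r0 rP] := nbhs_norm_ball (filterI dh ch').
move/cvgrPdist_le : dk => /(_ _ e20) dk.
pose M := `|c| * `|h| + `|k| + 1.
have M0 : 0 < M by rewrite /M ltr_wpDl// addr_ge0// mulr_ge0.
near=> s.
have s0 : s != 0 by near: s; exact: nbhs_dnbhs_neq.
have sM : `|s| < r / M.
  near: s; apply: dnbhs0_lt; exact: divr_gt0.
have skh : `|s| * (`|c| * `|h| + `|k|) < r.
  apply: le_lt_trans (_ : `|s| * M < _); last by rewrite -ltr_pdivlMr.
  by rewrite ler_wpM2l// /M lerDl.
have small t : `|t| <= `|s * c| -> `|s *: k + t *: h| < r.
  move=> tc; apply: le_lt_trans skh; apply: le_trans (ler_normD _ _) _.
  by rewrite !normrZ mulrDr addrC lerD// mulrA ler_wpM2r// -normrM.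
have [t tc E] : exists2 t, `|t| <= `|s * c| & f (p + s *: k + (s * c) *: h) - f (p + s *: k) =
    f1 (p + s *: k + t *: h) * (s * c).
  apply: (@MVT_line f (fun t => f1 (p + s *: k + t *: h))) => t tc.
  by have [+ _] := rP _ (small t tc); rewrite addrA.
have [_ Dt] := rP _ (small t tc); rewrite addrA in Dt.
have -> : s^-1 *: (f (s *: (c *: h + k) + p) - f p) =
    c * f1 (p + s *: k + t *: h) + s^-1 *: (f (s *: k + p) - f p).
  rewrite (_ : s *: (c *: h + k) + p = p + s *: k + (s * c) *: h); last first.
    by rewrite scalerDr scalerA addrC addrAC addrA.
  rewrite (addrC (s *: k) p).
  rewrite -[f (p + s *: k + _)](subrK (f (p + s *: k))) E -addrA scalerDr.
  congr (_ + _); rewrite /GRing.scale /=; field; exact: s0.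
have Dk : `|d - s^-1 *: (f (s *: k + p) - f p)| <= e / 2 by near: s.
move: Dt Dk; set D := f1 (_ + _ + _); set Q := s^-1 *: _ => Dt Dk.
have -> : c * f1 p + d - (c * D + Q) = c * (f1 p - D) + (d - Q) by ring.
apply: le_trans (ler_normD _ _) _; rewrite (_ : e = e / 2 + e / 2); last by field.
apply: lerD => //; rewrite normrM.
apply: le_trans (_ : (`|c| + 1) * e' <= _); first by rewrite ler_pM// lerDl.
by rewrite /e' mulrC divfK// lt0r_neq0.
Unshelve. all: by end_near. Qed.

Lemma is_derive_dir0 f p : is_derive p 0 f 0.
Proof.
apply: cvg_is_derive.
rewrite (_ : (fun _ => _) = fun=> 0); first exact: cvg_cst.
by apply/funext => s; rewrite scaler0 add0r subrr scaler0.
Qed.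

Lemma is_derive_sum_dir (I : Type) (r : seq I) (e : I -> V) (c : I -> R) f (f1 : I -> V -> R) p :
  (forall i, \forall q \near p, is_derive q (e i) f (f1 i q)) ->
  (forall i, {for p, continuous (f1 i)}) ->
  is_derive p (\sum_(i <- r) c i *: e i) f (\sum_(i <- r) c i * f1 i p).
Proof.
move=> df cf; elim: r => [|i r IH]; first by rewrite !big_nil; exact: is_derive_dir0.
by rewrite !big_cons; apply: is_derive_addZ => //; apply: df.
Qed.

(** Two mean value steps, for q |-> f (q + s k) - f q along h and then for [f1] along k, give s^2
    times a value of [f2] close to p. *)
Lemma second_difference f (f1 f2 : V -> R) p h k (e : R) : 0 < e ->
  (\forall q \near p, is_derive q h f (f1 q)) ->
  (\forall q \near p, is_derive q k f1 (f2 q)) ->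
  {for p, continuous f2} ->
  \forall s \near (0 : R), `|f (p + s *: h + s *: k) - f (p + s *: h) - (f (p + s *: k) - f p)
     - f2 p * s ^+ 2| <= e * s ^+ 2.
Proof.
move=> e0 dh dhk c.
have c' : \forall q \near p, `|f2 p - f2 q| <= e.
  by move/cvgrPdist_le : c => /(_ _ e0).
have [r r0 rP] := nbhs_norm_ball (filterI (filterI dh dhk) c').
pose M := `|h| + `|k| + 1.
have M0 : 0 < M by rewrite /M ltr_wpDl// addr_ge0// mulr_ge0.
near=> s.
have sM : `|s| <= r / M / 2 by near: s; apply: near0_le; rewrite !divr_gt0.
have small t t' : `|t| <= `|s| -> `|t'| <= `|s| -> `|t *: h + t' *: k| < r.
  move=> ts t's; apply: le_lt_trans (_ : `|s| * M < _).
    apply: le_trans (ler_normD _ _) _; rewrite !normrZ /M !mulrDr -[X in X <= _]addr0.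
    by rewrite !lerD// ?ler_wpM2r// mulr_ge0.
  rewrite -ltr_pdivlMr//; apply: le_lt_trans sM _.
  by rewrite gtr_pMr ?divr_gt0//; lra.
pose F q := f (q + s *: k) - f q.
have [t ts E] : exists2 t, `|t| <= `|s| & F (p + s *: h) - F p =
    (f1 (p + t *: h + s *: k) - f1 (p + t *: h)) * s.
  apply: (@MVT_line F (fun t => f1 (p + t *: h + s *: k) - f1 (p + t *: h))) => t ts.
  apply: is_deriveB.
    apply: is_derive_shift.
    by have [[+ _] _] := rP _ (small t s ts (lexx _)); rewrite addrA.
  have := small t 0 ts; rewrite normr0 scale0r addr0 => /(_ (normr_ge0 _)) H.
  by have [[+ _] _] := rP _ H.
have [t' t's E'] : exists2 t', `|t'| <= `|s| & f1 (p + t *: h + s *: k) - f1 (p + t *: h)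
    = f2 (p + t *: h + t' *: k) * s.
  apply: (@MVT_line f1 (fun t' => f2 (p + t *: h + t' *: k))) => t' t's.
  by have [[_ +] _] := rP _ (small t t' ts t's); rewrite addrA.
have [_ H] := rP _ (small t t' ts t's).
move: E; rewrite E' /F => ->; rewrite -addrA; move: H.
set D := f2 (_ + _); set D0 := f2 p => H.
have -> : D * s * s - D0 * s ^+ 2 = - (D0 - D) * s ^+ 2 by ring.
by rewrite normrM normrN [`|s ^+ 2|]ger0_norm ?sqr_ge0// ler_wpM2r// sqr_ge0.
Unshelve. all: by end_near. Qed.

(** The second difference is symmetric in h and k, so both mixed derivatives are the limit of the
    same quotient. *)
Lemma derive_comm f (f1 f2 g1 g2 : V -> R) p h k :
  (\forall q \near p, is_derive q h f (f1 q)) -> (\forall q \near p, is_derive q k f1 (f2 q)) ->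
  (\forall q \near p, is_derive q k f (g1 q)) -> (\forall q \near p, is_derive q h g1 (g2 q)) ->
  {for p, continuous f2} -> {for p, continuous g2} -> f2 p = g2 p.
Proof.
move=> dh dhk dk dkh c1 c2; apply/eqP; rewrite -subr_eq0; apply/eqP.
have H e : 0 < e -> `|f2 p - g2 p| <= 2 * e.
  move=> e0; have S1 := second_difference e0 dh dhk c1.
  have S2 := second_difference e0 dk dkh c2.
  have [r /= r0 /(_ (r / 2))[]] := (nbhs_ballP _ _).1 (filterI S1 S2).
    by rewrite /ball /= sub0r normrN gtr0_norm; lra.
  have r2 : 0 < (r / 2) ^+ 2 by rewrite exprn_gt0// divr_gt0.
  move: (r / 2) r2 => s s2.
  rewrite (addrAC p (s *: k)); set x := f (_ + _ + _); set y := f (p + s *: h); set z := f (p + s *: k).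
  set D1 := f2 p; set D2 := g2 p; set w := f p => a b; rewrite -(ler_pM2r s2) -[X in _ * X <= _](gtr0_norm s2) -normrM.
  rewrite (_ : _ * _ = (x - z - (y - w) - D2 * s ^+ 2) - (x - y - (z - w) - D1 * s ^+ 2)); last by ring.
  apply: le_trans (ler_normB _ _) _.
  have -> : 2 * e * s ^+ 2 = e * s ^+ 2 + e * s ^+ 2 by ring.
  exact: lerD b a.
apply/eqP; rewrite -normr_le0; apply/ler_addgt0Pr => e e0; rewrite add0r.
have e2 : 0 < e / 2 by rewrite divr_gt0.
by have := H _ e2; rewrite (mulrC 2) divfK ?pnatr_eq0.
Unshelve. all: by end_near. Qed.

End DirectionalDerivatives.

(** [g1] is differentiable at 0 only, so the mean value theorem is applied once, to the remainder
    [rho], whose derivative is at most e |s|. *)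
Lemma jet2_taylor (R : realType) (g g1 : R -> R) (g2 : R) :
  (\forall s \near (0 : R), is_derive s (1 : R) g (g1 s)) -> is_derive (0 : R) (1 : R) g1 g2 ->
  jet2 g (g 0) (g1 0) (g2 / 2).
Proof.
move=> dg /is_derive_cvg/cvgrPdist_le dg1 e e0.
have := dg1 _ e0 => {}dg1.
have : \forall s \near (0:R), is_derive s (1 : R) g (g1 s) /\ `|g1 s - g1 0 - g2 * s| <= e * `|s|.
  near=> s; split; first by near: s.
  have [->|s0] := eqVneq s 0; first by rewrite mulr0 subr0 subrr normr0 mulr0.
  have : `|g2 - s^-1 *: (g1 (s *: 1 + 0) - g1 0)| <= e.
    by move: s0; near: s; exact: dg1.
  rewrite addr0 /GRing.scale /= mulr1 => H.
  rewrite (_ : _ - _ = - s * (g2 - s^-1 * (g1 s - g1 0))); last by field.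
  by rewrite normrM normrN mulrC ler_wpM2r.
move=> /nbhs_ballP[r /= r0 rP].
near=> s.
have sr : `|s| <= r / 2 by near: s; apply: near0_le; rewrite divr_gt0.
pose rho s := g s - (g 0 + g1 0 * s + g2 / 2 * s ^+ 2).
have drho t : `|t| <= `|s| -> is_derive t (1 : R) rho (g1 t - g1 0 - g2 * t).
  move=> ts; have [|D _] := rP t; first by rewrite /ball /= sub0r normrN; lra.
  rewrite /rho; apply: is_derive_eq.
  by rewrite /GRing.scale /=; field.
have [t ts E] : exists2 t, `|t| <= `|s| & rho (0 + s *: (1 : R)) - rho 0 = (g1 t - g1 0 - g2 * t) * s.
  apply: (@MVT_line R R rho (fun t => g1 t - g1 0 - g2 * t)) => x xs.
  by rewrite add0r [x *: _]mulr1; exact: drho.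
have [|_ H] := rP t; first by rewrite /ball /= sub0r normrN; lra.
move: E; rewrite add0r [s *: _]mulr1 {2}/rho mulr0 expr0n /= mulr0 !addr0 subrr subr0 => E.
rewrite -/(rho s) E normrM (_ : s ^+ 2 = `|s| * `|s|); last by rewrite -expr2 -normrX ger0_norm ?sqr_ge0.
by rewrite mulrA ler_wpM2r// (le_trans H)// ler_wpM2l// ltW.
Unshelve. all: by end_near. Qed.

(** * Smooth functions *)

Lemma nbhs_line (R : realType) (V : normedModType R) (U : set V) (p y : V) : nbhs p U -> \forall s \near (0 : R), U (p + s *: y).
Proof.
move=> Up; have [r r0 rU] := nbhs_norm_ball Up.
have y1 : 0 < `|y| + 1 by rewrite ltr_wpDl.
near=> s; apply: rU; rewrite normrZ.
have : `|s| <= r / (`|y| + 1) / 2 by near: s; apply: near0_le; rewrite !divr_gt0.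
move=> sr; apply: le_lt_trans (_ : `|s| * (`|y| + 1) < _).
  by rewrite ler_wpM2l// lerDl.
rewrite -ltr_pdivlMr//; apply: le_lt_trans sr _.
by rewrite gtr_pMr ?divr_gt0//; lra.
Unshelve. all: by end_near. Qed.

Section SmoothFunctions.
Variables (R : realType) (n : nat) (U : set ('rV[R]_n * R)).
Hypothesis U_open : open U.
Implicit Types (f u : 'rV[R]_n * R -> R) (p q y : 'rV[R]_n * R).

Lemma near_open p : U p -> \forall q \near p, U q.
Proof. by move=> Up; apply: open_nbhs_nbhs; split. Qed.

Lemma sum_option (M : nmodType) (F : option 'I_n -> M) :
  \sum_a F a = F None + \sum_i F (Some i).
Proof.
rewrite (bigD1 None)//=; congr (_ + _).
rewrite (reindex_omap Some id) /=; first by apply: eq_bigl => i; rewrite eqxx.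
by case.
Qed.

Definition coord y (a : option 'I_n) : R := if a is Some i then y.1 0 i else y.2.

Lemma sum_fst (I : Type) (r : seq I) (F : I -> 'rV[R]_n * R) :
  (\sum_(i <- r) F i).1 = \sum_(i <- r) (F i).1.
Proof. by elim: r => [|i r IH]; rewrite ?big_nil// !big_cons -IH. Qed.
Lemma sum_snd (I : Type) (r : seq I) (F : I -> 'rV[R]_n * R) :
  (\sum_(i <- r) F i).2 = \sum_(i <- r) (F i).2.
Proof. by elim: r => [|i r IH]; rewrite ?big_nil// !big_cons -IH. Qed.

Lemma sum_axis y : y = \sum_a coord y a *: axis a.
Proof.
rewrite sum_option; case: y => y t; congr pair => /=.
  rewrite sum_fst /= scaler0 add0r [LHS]row_sum_delta.
  by apply: eq_bigr.
rewrite sum_snd /= big1 ?addr0 => [|i _]; last by rewrite /GRing.scale /= mulr0.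
by rewrite /GRing.scale /= mulr1.
Qed.

Lemma smooth_partials s f : smooth_on U f -> smooth_on U (partials s f).
Proof.
by move=> sf s' p Up; have := sf (s' ++ s) p Up; rewrite /partials foldr_cat.
Qed.

Lemma smooth_partial a f : smooth_on U f -> smooth_on U (partial a f).
Proof. exact: (smooth_partials [:: a]). Qed.

Lemma smooth_is_derive f p a : smooth_on U f -> U p ->
  is_derive p (axis a) f (partial a f p).
Proof. by move=> sf Up; have [_ /(_ a)] := sf [::] p Up; split. Qed.

Lemma smooth_cont f p : smooth_on U f -> U p -> {for p, continuous f}.
Proof. by move=> sf Up; have [] := sf [::] p Up. Qed.

Definition dirD y f p : R := \sum_a coord y a * partial a f p.
Definition dirD2 y f p : R := \sum_a coord y a * dirD y (partial a f) p.

Lemma dirDP y f p : smooth_on U f -> U p -> is_derive p y f (dirD y f p).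
Proof.
move=> sf Up; rewrite [X in is_derive _ X](sum_axis y).
apply: (@is_derive_sum_dir _ _ _ _ _ _ f (fun a => partial a f)) => a; last exact: smooth_cont (smooth_partial a sf) Up.
by have := near_open Up; apply: filterS => q Uq; exact: smooth_is_derive.
Qed.

Lemma near_line p y : U p -> \forall s \near (0 : R), U (p + s *: y).
Proof. by move=> /near_open/nbhs_line; exact. Qed.

Lemma is_derive_sumr (I : Type) (r : seq I) (V : normedModType R)
    (x v : V) (g : I -> V -> R) (d : I -> R) (c : I -> R) :
  (forall i, is_derive x v (g i) (d i)) ->
  is_derive x v (fun t => \sum_(i <- r) c i * g i t) (\sum_(i <- r) c i * d i).
Proof.
move=> dg; elim: r => [|i r IH].
  rewrite big_nil (_ : (fun _ => _) = fun=> 0); first exact: is_derive_cst.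
  by apply/funext => t; rewrite big_nil.
have H := is_deriveD (is_deriveZ (c i) (dg i)) IH.
rewrite big_cons.
apply: (eq_rect _ (fun h => is_derive x v h (c i * d i + \sum_(j <- r) c j * d j)) H).
by apply/funext => t; rewrite big_cons.
Qed.

Lemma jet2_line f p y : smooth_on U f -> U p ->
  jet2 (fun s => f (p + s *: y)) (f p) (dirD y f p) (dirD2 y f p / 2).
Proof.
move=> sf Up.
have := @jet2_taylor R (fun s => f (p + s *: y)) (fun s => dirD y f (p + s *: y)) (dirD2 y f p).
rewrite !scale0r !addr0; apply.
  apply: filterS (near_line y Up) => s Us.
  by apply: is_derive_line; exact: dirDP.
apply: is_derive_sumr => a; apply: is_derive_line; rewrite scale0r addr0.
by apply: dirDP; [exact: smooth_partial | exact: Up].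
Qed.

Lemma partialC f p a b : smooth_on U f -> U p ->
  partial a (partial b f) p = partial b (partial a f) p.
Proof.
move=> sf Up; have UN := near_open Up.
have D c g : smooth_on U g -> \forall q \near p, is_derive q (axis c) g (partial c g q).
  by move=> sg; apply: filterS UN => q Uq; exact: smooth_is_derive.
have C c g : smooth_on U g -> {for p, continuous (partial c g)}.
  by move=> sg; apply: smooth_cont Up; exact: smooth_partial.
have S c := smooth_partial c sf.
exact: (derive_comm (D b f sf) (D a _ (S b)) (D a f sf) (D b _ (S a)) (C a _ (S b)) (C b _ (S a))).
Qed.

(** By induction it suffices to carry one index to the front by exchanges of neighbours. An equality
    below an outer derivative is needed near p, hence the use of [near_eq_derive] and of the
    openness of U. *)
Lemma partials_perm s t f p : smooth_on U f -> perm_eq s t -> U p ->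
  partials s f p = partials t f p.
Proof.
move=> sf; elim: s t p => [|a s IH] t p st Up.
  by move: st; rewrite perm_sym => /perm_nilP ->.
have at_ : a \in t by rewrite -(perm_mem st) mem_head.
case: (path.splitPr at_) st => t1 t2 st.
have {}st : perm_eq s (t1 ++ t2).
  by move: st; rewrite perm_sym -cat1s perm_catCA /= perm_cons perm_sym.
have -> : partials (a :: s) f p = partials (a :: (t1 ++ t2)) f p.
  by apply: near_eq_derive; apply: filterS (near_open Up) => q /IH; exact.
elim: t1 p Up {st IH} => [//|b t1 IH] p Up.
rewrite [LHS](_ : _ = partial b (partial a (partials (t1 ++ t2) f)) p).
  by apply: near_eq_derive; apply: filterS (near_open Up) => q /IH.
by apply: partialC; [exact: smooth_partials | exact: Up].
Qed.

End SmoothFunctions.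

(** * The twice differentiated equation *)

Lemma jet2_bil (R : realType) (n : nat) (A : R -> 'M[R]_n) (A0 A1 A2 : 'M[R]_n) (x y : 'rV[R]_n) :
  (forall i j, jet2 (fun s => A s i j) (A0 i j) (A1 i j) (A2 i j)) ->
  jet2 (fun s => bil (A s) (x + s *: y) (x + s *: y)) (bil A0 x x)
    (bil A1 x x + bil A0 x y + bil A0 y x)
    (bil A2 x x + bil A1 x y + bil A1 y x + bil A0 y y).
Proof.
move=> jA.
have J z t : jet2 (fun s => bil (A s) z t) (bil A0 z t) (bil A1 z t) (bil A2 z t).
  rewrite !bilE.
  have := jet2_sum (index_enum 'I_n) xpredT (fun i => jet2_sum (index_enum 'I_n) xpredT
    (fun j => jet2M (jA i j) (jet2_cst (z 0 i * t 0 j)))).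
  move=> H; apply: (jet2_near _ (jet2_eq _ _ _ H)).
  - by near=> s; rewrite bilE.
  - by [].
  - by apply: eq_bigr => i _; apply: eq_bigr => j _; ring.
  - by apply: eq_bigr => i _; apply: eq_bigr => j _; ring.
have Jid := jet2_affine (0 : R) 1.
have := jet2D (J x x) (jet2D (jet2M Jid (jet2D (J x y) (J y x))) (jet2M (jet2M Jid Jid) (J y y))).
move=> H; apply: (jet2_near _ (jet2_eq _ _ _ H)).
- by near=> s; rewrite !bilL; ring.
- by ring.
- by ring.
- by ring.
Unshelve. all: by end_near. Qed.

(* Sealed: comparing unfolded iterated derivatives makes unification explode. *)
HB.lock Definition pd (R : realType) (n : nat) (u : 'rV[R]_n * R -> R)
  (s : seq (option 'I_n)) (p : 'rV[R]_n * R) : R := partials s u p.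
Canonical pd_unlockable := Unlockable pd.unlock.

Section IteratedPartials.
Variables (R : realType) (n : nat) (u : 'rV[R]_n * R -> R).
Implicit Types (p y : 'rV[R]_n * R) (s : seq (option 'I_n)).

Definition pdir y s p : R := \sum_a coord y a * pd u (a :: s) p.
Definition pdir2 y s p : R := \sum_a coord y a * pdir y (a :: s) p.

Lemma pdir_pair (x : 'rV[R]_n) (t : R) s p :
  pdir (x, t) s p = t * pd u (None :: s) p + \sum_j x 0 j * pd u (Some j :: s) p.
Proof. by rewrite /pdir sum_option. Qed.

Lemma pdir_x (x : 'rV[R]_n) s p :
  pdir (x, 0) s p = \sum_j x 0 j * pd u (Some j :: s) p.
Proof. by rewrite pdir_pair mul0r add0r. Qed.

Lemma sum_delta (F : 'I_n -> R) k j : \sum_i (k *: (delta_mx 0 j : 'rV[R]_n)) 0 i * F i = k * F j.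
Proof.
rewrite (bigD1 j)//= !mxE !eqxx mulr1 big1 ?addr0// => i ij.
by rewrite !mxE (negbTE ij) mulr0 mul0r.
Qed.

Lemma pdir_delta k j (t : R) s p :
  pdir (k *: delta_mx 0 j, t) s p = t * pd u (None :: s) p + k * pd u (Some j :: s) p.
Proof. by rewrite pdir_pair sum_delta. Qed.

Lemma pdir2_delta k j (t : R) s p : pdir2 (k *: delta_mx 0 j, t) s p =
    t * (t * pd u [:: None, None & s] p + k * pd u [:: Some j, None & s] p)
    + k * (t * pd u [:: None, Some j & s] p + k * pd u [:: Some j, Some j & s] p).
Proof. by rewrite /pdir2 sum_option /= sum_delta !pdir_delta. Qed.

End IteratedPartials.

(** * Pointwise inequalities for the second variation of W(xi, xi) *)

Section DonaldsonPointwise.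
Variables (R : realType) (n : nat) (U : set ('rV[R]_n * R)) (eps : R).
Variable u : 'rV[R]_n * R -> R.
Hypotheses (U_open : open U) (eps_gt0 : 0 < eps) (u_smooth : smooth_on U u).
Hypothesis u_eq : forall p, U p -> donaldson eps u p.
Hypothesis u_psd : forall p, U p -> psd (hessian u p + 1%:M).
Implicit Types (p y : 'rV[R]_n * R) (xi eta : 'rV[R]_n).

Lemma pd_perm p s t : perm_eq s t -> U p -> pd u s p = pd u t p.
Proof. by rewrite unlock; exact: partials_perm. Qed.

Lemma jet2_pd y s p : U p ->
  jet2 (fun t => pd u s (p + t *: y)) (pd u s p) (pdir u y s p) (pdir2 u y s p / 2).
Proof.
by move=> Up; rewrite /pdir2 /pdir unlock; apply: jet2_line; [exact: U_open | exact: smooth_partials | exact: Up].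
Qed.

Definition Wm p : 'M[R]_n := hessian u p + 1%:M.
Definition utt p : R := pd u [:: None; None] p.
Definition gradt p : 'rV[R]_n := \row_j pd u [:: None; Some j] p.
Definition dW p y : 'M[R]_n := \matrix_(i, j) pdir u y [:: Some j; Some i] p.
(* Half the second derivative: the s^2 coefficient of Wm (p + s y). *)
Definition d2W p y : 'M[R]_n :=
  \matrix_(i, j) (pdir2 u y [:: Some j; Some i] p / 2).
(* third and thirdt are D_x^2 u_xi and grad_x u_(t xi). *)
Definition third p xi : 'M[R]_n :=
  \matrix_(j, k) \sum_l xi 0 l * pd u [:: Some j; Some k; Some l] p.
Definition thirdt p xi : 'rV[R]_n :=
  \row_k \sum_l xi 0 l * pd u [:: None; Some k; Some l] p.
Definition tau p xi : R := \tr (third p xi) / \tr (Wm p).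
(* With weights om, the fields Yv decompose utt times the linearized operator. *)
Definition Yv p (a : option 'I_n) : 'rV[R]_n * R :=
  if a is Some j then (utt p *: delta_mx 0 j, - gradt p 0 j) else (0, 1).
Definition om (a : option 'I_n) : R := if a is Some _ then 1 else eps.
Definition etav p xi (a : option 'I_n) : 'rV[R]_n :=
  if a is Some j then eta_x (utt p) (\tr (Wm p)) (tau p xi) (thirdt p xi) (gradt p) j
  else eta_t (\tr (Wm p)) (thirdt p xi).

Lemma om_ge0 a : 0 <= om a.
Proof. by case: a => //=; exact: ltW. Qed.

Lemma WmE p i j : Wm p i j = pd u [:: Some j; Some i] p + (i == j)%:R.
Proof. by rewrite unlock !mxE. Qed.

Lemma pde p : U p -> pd u [:: None; None] p *
  (n%:R + \sum_j pd u [:: Some j; Some j] p)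
  - \sum_j pd u [:: None; Some j] p ^+ 2 = eps.
Proof. by rewrite unlock => Up; exact: u_eq. Qed.

Lemma pd_swap2 p a b : U p -> pd u [:: a; b] p = pd u [:: b; a] p.
Proof.
by move=> Up; apply: pd_perm Up; apply/permP => P /=; ring.
Qed.

Lemma pd_swap3 p a b c : U p -> pd u [:: a; b; c] p = pd u [:: b; a; c] p.
Proof.
by move=> Up; apply: pd_perm Up; apply/permP => P /=; ring.
Qed.

Lemma pd_rot3 p a b c : U p -> pd u [:: a; b; c] p = pd u [:: b; c; a] p.
Proof.
by move=> Up; apply: pd_perm Up; apply/permP => P /=; ring.
Qed.

Lemma pd_swap4 p a b c d : U p ->
  pd u [:: a; b; c; d] p = pd u [:: b; a; c; d] p.
Proof.
by move=> Up; apply: pd_perm Up; apply/permP => P /=; ring.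
Qed.

Lemma pd_rot4 p a b c d : U p ->
  pd u [:: a; b; c; d] p = pd u [:: c; d; a; b] p.
Proof.
by move=> Up; apply: pd_perm Up; apply/permP => P /=; ring.
Qed.

Lemma Wm_sym p : U p -> (Wm p)^T = Wm p.
Proof.
move=> Up; apply/matrixP => i j; rewrite [LHS]mxE !WmE eq_sym.
by rewrite (pd_swap2 _ _ Up).
Qed.

Lemma dW_sym p y : U p -> (dW p y)^T = dW p y.
Proof.
move=> Up; apply/matrixP => i j; rewrite !mxE; apply: eq_bigr => a _.
have E : pd u [:: a; Some i; Some j] p = pd u [:: a; Some j; Some i] p.
  by rewrite (pd_rot3 _ _ _ Up) [RHS](pd_rot3 _ _ _ Up) (pd_swap3 _ _ _ Up).
by rewrite E.
Qed.

Lemma third_sym p xi : U p -> (third p xi)^T = third p xi.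
Proof.
move=> Up; apply/matrixP => i j; rewrite !mxE; apply: eq_bigr => a _.
by rewrite pd_swap3.
Qed.

Lemma trace_Wm p : \tr (Wm p) = n%:R + \sum_j pd u [:: Some j; Some j] p.
Proof.
rewrite /mxtrace; under eq_bigr => i _ do rewrite WmE eqxx.
by rewrite big_split /= sumr_const card_ord addrC.
Qed.

Lemma donaldson_eq p : U p -> utt p * \tr (Wm p) = eps + dot (gradt p) (gradt p).
Proof.
move=> Up; rewrite -(pde Up) trace_Wm dotE.
under [X in _ = _ + X]eq_bigr => j _ do rewrite !mxE -expr2.
by rewrite subrK.
Qed.

Lemma trace_Wm_gt0 p : U p -> 0 < \tr (Wm p).
Proof.
move=> Up; rewrite lt_neqAle; apply/andP; split.
  apply/eqP => E; have := donaldson_eq Up; rewrite -E mulr0 => /eqP.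
  by rewrite lt_eqF// ltr_pwDl// dot_ge0.
rewrite trace_bil sumr_ge0// => i _; exact: u_psd.
Qed.

Lemma jet2_Wm p y i j : U p ->
  jet2 (fun s => Wm (p + s *: y) i j) (Wm p i j) (dW p y i j) (d2W p y i j).
Proof.
move=> Up; have := jet2D (jet2_pd y [:: Some j; Some i] Up) (jet2_cst (i == j)%:R).
have E1 : dW p y i j = pdir u y [:: Some j; Some i] p by rewrite mxE.
have E2 : d2W p y i j = pdir2 u y [:: Some j; Some i] p / 2 by rewrite mxE.
move=> J; apply: (jet2_near _ (jet2_eq _ _ _ J)).
- by near=> s; rewrite WmE.
- by rewrite WmE.
- by rewrite E1 addr0.
- by rewrite E2 addr0.
Unshelve. all: by end_near. Qed.

Lemma bil_dW p y xi eta :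
  bil (dW p y) xi eta = bil (third p xi) y.1 eta + y.2 * dot (thirdt p xi) eta.
Proof.
case: y => x t /=.
rewrite [LHS]bilE [LHS]exchange_big /= [dot _ _]dotE mulr_sumr (bilE (third p xi)) [X in _ = X + _]exchange_big -big_split /=.
apply: eq_bigr => k _.
under eq_bigr => i _ do rewrite mxE pdir_pair mulrDl mulr_suml.
rewrite big_split /= addrC exchange_big /=; congr +%R.
  apply: eq_bigr => j _; rewrite mxE mulr_suml; apply: eq_bigr => l _.
  by ring.
by rewrite mxE mulr_suml mulr_sumr; apply: eq_bigr => l _; ring.
Qed.

(** It has two readings: d_a d_b of D_x^2 u (xi, xi) with xi frozen, which is how it occurs in
    [d2W], and, by commuting partials, the second xi-derivative of u_ab, which is how it occurs in
    the differentiated equation. *)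
Definition fourth p xi (a b : option 'I_n) : R :=
  \sum_l \sum_k pd u [:: a; b; Some k; Some l] p * (xi 0 l * xi 0 k).

Lemma bil_d2W_delta p xi k j (t : R) : U p ->
  bil (d2W p (k *: delta_mx 0 j, t)) xi xi =
  (t ^+ 2 * fourth p xi None None + 2 * t * k * fourth p xi None (Some j)
   + k ^+ 2 * fourth p xi (Some j) (Some j)) / 2.
Proof.
move=> Up; rewrite bilE /fourth !mulr_sumr -!big_split /= mulr_suml.
apply: eq_bigr => l _; rewrite !mulr_sumr -!big_split /= mulr_suml.
apply: eq_bigr => m _; rewrite mxE pdir2_delta.
have E : pd u [:: Some j; None; Some m; Some l] p = pd u [:: None; Some j; Some m; Some l] p.
  exact: pd_swap4.
by rewrite E; field.
Qed.

(** Along p + s (xi, 0) the equation says that a function of s vanishes near 0, so its coefficients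
    of s and s^2 vanish; the second identity is thus half of the second derivative. *)
Lemma donaldson_derivatives p xi : U p ->
  let b := thirdt p xi in let g := gradt p in
  let v := \sum_l xi 0 l * pd u [:: Some l; None; None] p in
  utt p * \tr (third p xi) + v * \tr (Wm p) - 2 * dot g b = 0 /\
  utt p * \sum_j fourth p xi (Some j) (Some j) / 2 + v * \tr (third p xi)
   + \tr (Wm p) * (fourth p xi None None / 2) - \sum_j g 0 j * fourth p xi None (Some j) - dot b b = 0.
Proof.
move=> Up b g v; set y := (xi, 0 : R).
have D1 s : pdir u y s p = \sum_l xi 0 l * pd u (Some l :: s) p.
  exact: pdir_x.
have D2 a c : pdir2 u y [:: a; c] p = fourth p xi a c.
  rewrite /pdir2 sum_option /= mul0r add0r; apply: eq_bigr => l _.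
  rewrite pdir_x mulr_sumr; apply: eq_bigr => k _.
  by rewrite mulrA mulrC (pd_rot4 _ _ _ _ Up).
have J s := jet2_pd y s Up.
have Jtr := jet2D (jet2_cst n%:R) (jet2_sum (index_enum 'I_n) xpredT (fun j => J [:: Some j; Some j])).
have Jg := jet2_sum (index_enum 'I_n) xpredT (fun j => jet2M (J [:: None; Some j]) (J [:: None; Some j])).
have := jet2D (jet2D (jet2M (J [:: None; None]) Jtr) (jet2N Jg)) (jet2_cst (- eps)).
set c0 := (X in jet2 _ X); have -> : c0 = 0.
  rewrite /c0; apply/eqP; rewrite addr_eq0 opprK; apply/eqP; rewrite -(pde Up).
  by congr (_ - _); apply: eq_bigr => j _; rewrite expr2.
move/jet2_eq0; case.
  have := near_line U_open y Up; apply: filterS => s Us.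
  apply/eqP; rewrite addr_eq0 opprK; apply/eqP; rewrite -(pde Us).
  by congr (_ - _); apply: eq_bigr => j _; rewrite expr2.
have trE : \sum_j pdir u y [:: Some j; Some j] p = \tr (third p xi).
  rewrite /mxtrace; apply: eq_bigr => j _; rewrite D1 mxE; apply: eq_bigr => l _.
  by rewrite (pd_rot3 _ _ _ Up).
have bE j : pdir u y [:: None; Some j] p = b 0 j.
  rewrite D1 mxE; apply: eq_bigr => l _.
  by rewrite (pd_rot3 _ _ _ Up).
have gE j : pd u [:: None; Some j] p = g 0 j by rewrite mxE.
rewrite -trace_Wm !add0r !addr0 trE (D1 [:: None; None]) -/v => E1 E2; split.
  rewrite -[RHS]E1 -/(utt p); congr (_ - _); rewrite dotE mulr_sumr.
  by apply: eq_bigr => j _; rewrite bE gE; ring.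
rewrite -[RHS]E2 D2 -/(utt p).
under [X in _ = _ - X]eq_bigr => j _ do rewrite bE gE D2.
under [X in _ = _ * X + _ + _ - _]eq_bigr => j _ do rewrite D2.
rewrite -addrA -opprD; congr (_ - _).
  by rewrite [in RHS](mulrC (fourth _ _ _ _ / 2)).
by rewrite dotE -big_split /=; apply: eq_bigr => j _; field.
Qed.

Lemma bil_d2W_t p xi : bil (d2W p (0, 1)) xi xi = fourth p xi None None / 2.
Proof.
have P s : pdir u (0, 1) s p = pd u (None :: s) p.
  by rewrite pdir_pair mul1r big1 ?addr0// => j _; rewrite mxE mul0r.
rewrite bilE /fourth mulr_suml; apply: eq_bigr => l _; rewrite mulr_suml; apply: eq_bigr => k _.
rewrite mxE /pdir2 sum_option /= mul1r big1 ?addr0 => [|j _]; last by rewrite mxE mul0r.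
by rewrite P; ring.
Qed.

(** The s^2 coefficient of W(xi + s eta, xi + s eta) along p + s [Yv p a], by the symmetry of [dW];
    it is half of the second derivative. *)
Definition second_variation p xi a eta : R :=
  bil (d2W p (Yv p a)) xi xi + 2 * bil (dW p (Yv p a)) xi eta + bil (Wm p) eta eta.

(** Because eps + |g|^2 = T s, the fourth order terms add up to T times half of L (W xi . xi). The
    first identity of [donaldson_derivatives] eliminates [v], and the second then turns these terms
    into T (|b - tau g|^2 + eps tau^2), exactly what [key_inequality] absorbs. *)
Lemma second_variation_le0 p xi : U p ->
  \sum_a om a * second_variation p xi a (etav p xi a) <= 0.
Proof.
move=> Up; have [] := donaldson_derivatives xi Up.
have s0 := trace_Wm_gt0 Up; have sn := lt0r_neq0 s0.
have trA : \tr (third p xi) = \tr (Wm p) * tau p xi by rewrite /tau; field.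
have := key_inequality (thirdt p xi) (Wm_sym Up) (u_psd Up) (third_sym xi Up) erefl s0 eps_gt0 (donaldson_eq Up) trA.
have TE := donaldson_eq Up.
rewrite trA sum_option /= /second_variation /= bil_d2W_t bil_dW /= bil0l mul1r add0r.
set b := thirdt p xi in trA *; set g := gradt p in TE *; set T := utt p in TE *.
set s := \tr (Wm p) in s0 sn trA TE *; set t := tau p xi in trA *.
set S := \sum_j (2 * _ + _); set E := eps * _; set v := \sum_l _ => K E1 E2.
set F0 := fourth p xi None None in E2 *.
have -> : \sum_(j < n) 1 * (bil (d2W p (T *: delta_mx 0 j, - g 0 j)) xi xi +
      2 * bil (dW p (T *: delta_mx 0 j, - g 0 j)) xi (eta_x T s t b g j) +
      bil (Wm p) (eta_x T s t b g j) (eta_x T s t b g j)) =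
  T ^+ 2 * (\sum_j fourth p xi (Some j) (Some j) / 2)
  - T * (\sum_j g 0 j * fourth p xi None (Some j)) + dot g g * (F0 / 2) + S.
  rewrite dotE !mulr_sumr mulr_suml -sumrB -!big_split /=; apply: eq_bigr => j _.
  by rewrite bil_d2W_delta// bil_dW /= bilZl -/F0 -/b; field.
have Ed : eps = T * s - dot g g by rewrite TE addrK.
have N : dot (b - t *: g) (b - t *: g) + eps * t ^+ 2 =
   dot b b - 2 * t * dot g b + T * s * t ^+ 2.
  rewrite Ed /dot !bilL -!/(dot _ _) (dotC b g); ring.
rewrite N in K.
have Sle : S <= - (T * (dot b b - 2 * t * dot g b + T * s * t ^+ 2)) - E.
  by rewrite lerBrDr; move: K; rewrite /E.
have vE : v = (2 * dot g b - T * (s * t)) / s.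
  by apply: (mulIf sn); rewrite divfK//; apply/eqP; rewrite -subr_eq0; apply/eqP; rewrite -[RHS]E1; ring.
move: E2; rewrite vE => E2.
have {}E2 : \sum_j g 0 j * fourth p xi None (Some j) = T * \sum_j fourth p xi (Some j) (Some j) / 2 + (2 * dot g b - T * (s * t)) / s * (s * t) + s * (F0 / 2) - dot b b.
  by apply/eqP; rewrite -subr_eq0 -oppr_eq0; apply/eqP; rewrite -[RHS]E2; ring.
rewrite E2; apply: le_trans (lerD (lexx _) (lerD (lexx _) Sle)) _.
rewrite /E le_eqVlt; apply/orP; left; apply/eqP; rewrite Ed; field; exact: sn.
Qed.

Lemma null_second_variation_ge0 p y xi eta : U p -> bil (Wm p) xi xi = 0 ->
  0 <= bil (d2W p y) xi xi + 2 * bil (dW p y) xi eta + bil (Wm p) eta eta.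
Proof.
move=> Up W0.
have := jet2_bil xi eta (fun i j => jet2_Wm y i j Up); rewrite W0.
move/jet2_ge0; case.
  by have := near_line U_open y Up; apply: filterS => s Us; exact: u_psd.
by rewrite (bilC eta xi (dW_sym y Up)) => _; congr (_ <= _); ring.
Qed.

(** At a null vector each second variation is nonnegative for every eta, while the sum at [etav]
    with positive weights is nonpositive. So each of them vanishes at [etav], which therefore
    minimizes it, and the derivative in eta is 0 there. *)
Lemma null_dW p xi zeta a : U p -> bil (Wm p) xi xi = 0 ->
  bil (dW p (Yv p a)) xi zeta = - bil (Wm p) (etav p xi a) zeta.
Proof.
move=> Up W0; apply/eqP; rewrite -subr_eq0 opprK; apply/eqP.
have V0 b eta : 0 <= second_variation p xi b eta by exact: null_second_variation_ge0.
have Va : second_variation p xi a (etav p xi a) = 0.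
  have := second_variation_le0 xi Up; rewrite (bigD1 a)//= => S.
  have S' : 0 <= \sum_(i | i != a) om i * second_variation p xi i (etav p xi i).
    by apply: sumr_ge0 => i _; rewrite mulr_ge0// om_ge0.
  have oa : 0 < om a by case: a {S S'} => //=.
  apply/eqP; rewrite eq_le V0 andbT -(pmulr_rle0 _ oa); lra.
apply: (@quad_ge0_lin0 _ _ (bil (Wm p) zeta zeta)) => s.
have := V0 a (etav p xi a + s *: zeta).
suff -> : second_variation p xi a (etav p xi a + s *: zeta) = second_variation p xi a (etav p xi a) +
  (2 * s * (bil (dW p (Yv p a)) xi zeta + bil (Wm p) (etav p xi a) zeta) + s ^+ 2 * bil (Wm p) zeta zeta).
  by rewrite Va add0r.
rewrite /second_variation !bilL (bilC zeta (etav p xi a) (Wm_sym Up)); ring.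
Qed.

End DonaldsonPointwise.

(** * Euclidean balls *)

Section PointwiseContinuity.
Variables (R : realType) (T : topologicalType).
Implicit Types (f g : T -> R) (x : T).

Lemma for_continuous_cst (a : R) x : {for x, continuous (fun=> a : R)}.
Proof. exact: cvg_cst. Qed.

Lemma for_continuousD f g x : {for x, continuous f} -> {for x, continuous g} ->
  {for x, continuous (fun t => f t + g t)}.
Proof. by move=> cf cg; exact: cvgD cf cg. Qed.

Lemma for_continuousM f g x : {for x, continuous f} -> {for x, continuous g} ->
  {for x, continuous (fun t => f t * g t)}.
Proof. by move=> cf cg; exact: cvgM cf cg. Qed.

Lemma for_continuousN f x : {for x, continuous f} -> {for x, continuous (fun t => - f t)}.
Proof. by move=> cf; exact: cvgN cf. Qed.

Lemma for_continuousX f x k : {for x, continuous f} ->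
  {for x, continuous (fun t => f t ^+ k)}.
Proof.
move=> cf; elim: k => [|k IH].
  rewrite (_ : (fun _ => _) = fun=> 1); first exact: for_continuous_cst.
  by apply/funext => t; rewrite expr0.
rewrite (_ : (fun _ => _) = fun t => f t * f t ^+ k); first exact: for_continuousM.
by apply/funext => t; rewrite exprS.
Qed.

Lemma for_continuous_sum (I : Type) (r : seq I) (f : I -> T -> R) x :
  (forall i, {for x, continuous (f i)}) ->
  {for x, continuous (fun t => \sum_(i <- r) f i t)}.
Proof.
move=> cf; elim: r => [|i r IH].
  rewrite (_ : (fun _ => _) = fun=> 0); first exact: for_continuous_cst.
  by apply/funext => t; rewrite big_nil.
rewrite (_ : (fun _ => _) = fun t => f i t + \sum_(j <- r) f j t); first exact: for_continuousD.
by apply/funext => t; rewrite big_cons.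
Qed.

Lemma for_continuous_comp (S : topologicalType) (h : S -> T) f y :
  {for y, continuous h} -> {for h y, continuous f} -> {for y, continuous (fun t => f (h t))}.
Proof. by move=> ch cf; exact: continuous_comp ch cf. Qed.

End PointwiseContinuity.

Section EuclideanBalls.
Variables (R : realType) (n : nat).
Local Notation P := ('rV[R]_n * R)%type.
Implicit Types (p q y z : P) (x : 'rV[R]_n).

Lemma coord_cont x i : {for x, continuous (fun v : 'rV[R]_n => v 0 i)}.
Proof. exact: coord_continuous. Qed.

Lemma bil_diag_cont (A : 'M[R]_n) x : {for x, continuous (fun v : 'rV[R]_n => bil A v v)}.
Proof.
rewrite (_ : (fun _ => _) = fun v : 'rV[R]_n => \sum_i \sum_j A i j * (v 0 i * v 0 j)); last first.
  by apply/funext => v; rewrite bilE.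
apply: for_continuous_sum => i; apply: for_continuous_sum => j.
apply: for_continuousM; first exact: for_continuous_cst.
by apply: for_continuousM; exact: coord_cont.
Qed.

Lemma dot_cont x : {for x, continuous (fun v : 'rV[R]_n => dot v v)}.
Proof. exact: bil_diag_cont. Qed.

Lemma fst_cont (S T : topologicalType) (z : S * T) : {for z, continuous (@fst S T)}.
Proof. exact: cvg_fst. Qed.
Lemma snd_cont (S T : topologicalType) (z : S * T) : {for z, continuous (@snd S T)}.
Proof. exact: cvg_snd. Qed.

Definition ip y z : R := dot y.1 z.1 + y.2 * z.2.
(** The ambient norm of the product is a maximum; the squared Euclidean distance is instead
    quadratic along lines, as the barrier requires. *)
Definition dist2 c p : R := ip (p - c) (p - c).

Lemma ip_ge0 y : 0 <= ip y y.
Proof. by rewrite addr_ge0 ?dot_ge0// -expr2 sqr_ge0. Qed.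

Lemma dist2C c p : dist2 c p = dist2 p c.
Proof. by rewrite /dist2 /ip /dot -(opprB c p) /= !bilNl !bilNr; ring. Qed.

Lemma dist2xx c : dist2 c c = 0.
Proof. by rewrite /dist2 /ip /dot subrr /= bil0l mulr0 addr0. Qed.

Lemma dist2_line c p y (s : R) : dist2 c (p + s *: y) =
  dist2 c p + 2 * ip (p - c) y * s + ip y y * s ^+ 2.
Proof.
rewrite /dist2 (addrAC p); move: (p - c) => z.
rewrite /ip /dot /= !bilL (bilC y.1 z.1 (trmx1 R n)) /GRing.scale /=; ring.
Qed.

Lemma dist2_cont c p : {for p, continuous (dist2 c)}.
Proof.
rewrite (_ : dist2 c = fun q => \sum_i (q.1 0 i + - c.1 0 i) * (q.1 0 i + - c.1 0 i) + (q.2 + - c.2) * (q.2 + - c.2)); last first.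
  apply/funext => q; rewrite /dist2 /ip dotE /=; congr (_ + _).
  by apply: eq_bigr => i _; rewrite !mxE.
have c1 i : {for p, continuous (fun q : P => q.1 0 i + - c.1 0 i)}.
  apply: for_continuousD; last exact: for_continuous_cst.
  apply: (@for_continuous_comp _ _ _ _ (fun v : 'rV[R]_n => v 0 i)); [exact: fst_cont | exact: coord_cont].
have c2 : {for p, continuous (fun q : P => q.2 + - c.2)}.
  apply: for_continuousD; [exact: snd_cont | exact: for_continuous_cst].
apply: for_continuousD; last exact: for_continuousM.
by apply: for_continuous_sum => i; exact: for_continuousM.
Qed.

Lemma sum_sqr_le x i : x 0 i ^+ 2 <= dot x x.
Proof.
rewrite dotE (bigD1 i)//= -expr2 lerDl sumr_ge0// => j _.
by rewrite -expr2 sqr_ge0.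
Qed.

Lemma sqr_le_itv (a r : R) : 0 <= r -> a ^+ 2 <= r ^+ 2 -> - r <= a <= r.
Proof. by move=> r0 H; rewrite -ler_norml -(@ler_pXn2r _ 2) ?nnegrE// real_normK ?num_real. Qed.

Lemma sphere_compact : compact [set x : 'rV[R]_n | dot x x = 1].
Proof.
have cb : compact [set v : 'rV[R]_n | forall i, v ord0 i \in `[(-1 : R), 1]].
  apply: (@rV_compact _ _ (fun=> `[(-1 : R), 1]%classic)) => _; exact: segment_compact.
apply: (subclosed_compact _ cb) => [|x /= x1 i].
  rewrite (_ : [set _ | _] = (fun v : 'rV[R]_n => dot v v) @^-1` [set 1]).
    by apply: preimage_closed => [v _|]; [exact: dot_cont | exact: closed_eq].
  by [].
rewrite in_itv /=; apply: sqr_le_itv => //.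
by rewrite expr1n -x1; exact: sum_sqr_le.
Qed.

Lemma ball_compact c (r : R) : 0 <= r -> compact [set p | dist2 c p <= r ^+ 2].
Proof.
move=> r0.
have cb : compact [set v : 'rV[R]_n | forall i, v ord0 i \in `[c.1 0 i - r, c.1 0 i + r]].
  apply: (@rV_compact _ _ (fun i => `[c.1 0 i - r, c.1 0 i + r]%classic)) => i; exact: segment_compact.
have cK := compact_setX cb (@segment_compact _ (c.2 - r) (c.2 + r)).
apply: (subclosed_compact _ cK) => [|[x t] /= pr].
  rewrite (_ : [set _ | _] = dist2 c @^-1` [set z | z <= r ^+ 2]) //.
  by apply: preimage_closed => [v _|]; [exact: dist2_cont | exact: closed_le].
have H (a b : R) : (a - b) ^+ 2 <= r ^+ 2 -> b - r <= a <= b + r.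
  by move=> /(sqr_le_itv r0); lra.
split=> [i|] /=; rewrite in_itv /=; apply: H; apply: le_trans pr; rewrite /dist2 /ip /=.
  apply: le_trans (_ : dot (x - c.1) (x - c.1) <= _); last by rewrite lerDl -expr2 sqr_ge0.
  by have := sum_sqr_le (x - c.1) i; rewrite !mxE.
by rewrite -expr2 lerDr dot_ge0.
Qed.

Lemma near_dist2 c (e : R) : 0 < e -> \forall p \near c, dist2 c p < e.
Proof.
move=> e0; have /cvgrPdist_lt/(_ _ e0) := dist2_cont (c := c) (p := c).
apply: filterS => p; rewrite dist2xx sub0r normrN; apply: le_lt_trans; exact: ler_norm.
Qed.

Lemma dist2_nbhs c (A : set P) : nbhs c A ->
  exists2 r : R, 0 < r & forall p, dist2 c p < r ^+ 2 -> A p.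
Proof.
case=> -[/= B C] [nB nC] BC.
have /nbhs_ballP[r1 /= r10 r1B] := nB; have /nbhs_ballP[r2 /= r20 r2C] := nC.
pose r := Num.min r1 r2.
have r0 : 0 < r by rewrite lt_min r10.
have H (a b : R) : (a - b) ^+ 2 < r ^+ 2 -> `|b - a| < r.
  by move=> ab; rewrite distrC -(@ltr_pXn2r _ 2) ?nnegrE ?(ltW r0)// real_normK ?num_real.
exists r => // -[x t] pr; apply: BC; split => /=.
  apply: r1B; split => [//|i j]; rewrite ord1 /ball /=.
  apply: lt_le_trans (_ : r <= _); last by rewrite ge_min lexx.
  apply: H; apply: le_lt_trans pr; rewrite /dist2 /ip /=.
  apply: le_trans (_ : dot (x - c.1) (x - c.1) <= _); last by rewrite lerDl -expr2 sqr_ge0.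
  by have := sum_sqr_le (x - c.1) j; rewrite !mxE.
apply: r2C; rewrite /ball /=.
apply: lt_le_trans (_ : r <= _); last by rewrite ge_min lexx orbT.
apply: H; apply: le_lt_trans pr; rewrite /dist2 /ip /=.
by rewrite -expr2 lerDr dot_ge0.
Qed.

End EuclideanBalls.

(** * Strong minimum principle for the least eigenvalue *)

Section StrongMinimumPrinciple.
Variables (R : realType) (n : nat).
Local Notation P := ('rV[R]_n * R)%type.
Variables (U : set P) (G : P -> 'M[R]_n) (dG d2G : P -> P -> 'M[R]_n).
Hypothesis G_jet : forall p y i j, U p ->
  jet2 (fun s => G (p + s *: y) i j) (G p i j) (dG p y i j) (d2G p y i j).
Hypothesis G_cont : forall p i j, U p -> {for p, continuous (fun q => G q i j)}.
Hypothesis G_psd : forall p, U p -> psd (G p).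
Implicit Types (p y : P) (xi eta : 'rV[R]_n).

(* The conditions met at p, xi when a C^2 function with value m, differential q
   and half second derivative Q at p touches the least eigenvalue of G from
   below. *)
Definition touching p xi (m : R) (q Q : P -> R) : Prop :=
  [/\ dot xi xi = 1, bil (G p) xi xi = m,
    forall eta, m * dot eta eta <= bil (G p) eta eta,
    forall y eta, bil (dG p y) xi xi + bil (G p) xi eta + bil (G p) eta xi
      = q y + 2 * m * dot xi eta &
    forall y eta, Q y + 2 * q y * dot xi eta + m * dot eta eta
      <= bil (d2G p y) xi xi + bil (dG p y) xi eta + bil (dG p y) eta xi
         + bil (G p) eta eta].

Lemma bil_cont p xi : U p ->
  {for (p, xi), continuous (fun z : P * 'rV[R]_n => bil (G z.1) z.2 z.2)}.
Proof.
move=> Up.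
rewrite (_ : (fun _ => _) = fun z : P * 'rV[R]_n =>
  \sum_i \sum_j G z.1 i j * (z.2 0 i * z.2 0 j)); last first.
  by apply/funext => z; rewrite bilE.
have cx i : {for (p, xi), continuous (fun z : P * 'rV[R]_n => z.2 0 i)}.
  apply: (@for_continuous_comp _ _ _ _ (fun v : 'rV[R]_n => v 0 i)); [exact: snd_cont | exact: coord_cont].
apply: for_continuous_sum => i; apply: for_continuous_sum => j.
apply: for_continuousM; last by apply: for_continuousM; exact: cx.
apply: (@for_continuous_comp _ _ _ _ (fun q : P => G q i j)); [exact: fst_cont | exact: G_cont].
Qed.

Lemma unit_coord xi i : dot xi xi = 1 -> `|xi 0 i| <= 1.
Proof.
move=> x1; rewrite ler_norml; apply: sqr_le_itv => //.
by rewrite expr1n -x1; exact: sum_sqr_le.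
Qed.

Lemma posdef_near c : U c -> (forall xi, dot xi xi = 1 -> 0 < bil (G c) xi xi) ->
  exists2 c0 : R, 0 < c0 & exists2 s : R, 0 < s &
    forall p xi, dist2 c p < s ^+ 2 -> dot xi xi = 1 -> c0 <= bil (G p) xi xi.
Proof.
move=> Uc Gpos.
(* For n = 0 the sphere is empty and has no minimum to take. *)
have [[xi0 x01]|noxi] := pselect (exists xi : 'rV[R]_n, dot xi xi = 1); last first.
  by exists 1 => //; exists 1 => // p xi _ x1; case: noxi; exists xi.
have cG : {within [set x : 'rV[R]_n | dot x x = 1], continuous (fun x => bil (G c) x x)}.
  by apply: continuous_in_subspaceT => x _; exact: bil_diag_cont.
have ne : [set x : 'rV[R]_n | dot x x = 1] !=set0 by exists xi0.
have [x1 + Hmin] := compact_EVT_min ne (@sphere_compact R n) cG.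
rewrite inE /= => x11; have m0 := Gpos _ x11; set m := bil _ _ _ in Hmin m0.
(* An entrywise change of at most e alters the form on unit vectors by at most n^2 e <= m / 2. *)
pose e := m / (2 * (n%:R ^+ 2 + 1)).
have n1 : 0 < n%:R ^+ 2 + 1 :> R by rewrite ltr_wpDl// sqr_ge0.
have e0 : 0 < e by rewrite divr_gt0// mulr_gt0.
exists (m / 2); first by rewrite divr_gt0.
have : \forall p \near c, forall i j, `|G c i j - G p i j| <= e.
  have H i j : \forall p \near c, `|G c i j - G p i j| <= e.
    by have /cvgrPdist_le/(_ _ e0) := @G_cont c i j Uc.
  have F := nbhs_filter c.
  exact: (@filter_forall _ _ _ _ F (fun i => @filter_forall _ _ _ _ F (H i))).
move=> /dist2_nbhs[s s0 sP]; exists s => // p xi ps xi1.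
have D : bil (G c) xi xi - bil (G p) xi xi <= m / 2.
  rewrite -bilNm -bilDm bilE.
  apply: le_trans (_ : \sum_(i < n) \sum_(j < n) e <= _).
    apply: ler_sum => i _; apply: ler_sum => j _.
    apply: le_trans (ler_norm _) _; rewrite !mxE normrM normrM.
    rewrite -[X in _ <= X]mulr1; apply: ler_pM => //; [exact: mulr_ge0 | exact: sP |].
    by rewrite -[X in _ <= X]mulr1; apply: ler_pM => //; exact: unit_coord.
  rewrite !sumr_const !card_ord -mulrnA -[e *+ _]mulr_natr natrM -expr2.
  have -> : m / 2 = e * (n%:R ^+ 2 + 1) by rewrite /e; field; exact: lt0r_neq0.
  by rewrite ler_wpM2l ?(ltW e0)// lerDl.
have := Hmin xi; rewrite inE /= => /(_ xi1); rewrite -/m; lra.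
Qed.

Variables (J : finType) (om : J -> R) (Y : J -> P -> P).
Variables (c : P) (r C C1 C2 C3 : R).
Hypotheses (r_gt0 : 0 < r) (ball_sub : forall p, dist2 c p <= r ^+ 2 -> U p).
(** The inequality L lambda <= C (|D lambda| + lambda) for the least eigenvalue lambda, in the
    viscosity sense: q and Q belong to the touching function, and B bounds its derivatives along the
    fields Y. *)
Hypothesis supersol : forall p xi m q Q B, dist2 c p <= r ^+ 2 -> 0 <= m ->
  touching p xi m q Q -> (forall j, `|q (Y j p)| <= B) ->
  \sum_j om j * Q (Y j p) <= C * (B + m).
Hypothesis elliptic : forall p, dist2 c p <= r ^+ 2 ->
  dist2 c p <= C1 * \sum_j om j * ip (p - c) (Y j p) ^+ 2.
Hypothesis Y_bound2 : forall p, dist2 c p <= r ^+ 2 ->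
  \sum_j om j * ip (Y j p) (Y j p) <= C2.
Hypothesis Y_bound1 : forall p j, dist2 c p <= r ^+ 2 -> `|ip (p - c) (Y j p)| <= C3.
Hypotheses (C_ge0 : 0 <= C) (C1_gt0 : 0 < C1) (C2_ge0 : 0 <= C2) (C3_ge0 : 0 <= C3).

(* For k large the barrier b (r^2 - |q - c|^2)^(k + 2) is a strict subsolution
   on every ring s <= |q - c| < r, so no Hopf lemma is needed. *)
Lemma touching_barrier p xi (b mu : R) k :
  U p -> (forall q x, dist2 c q <= r ^+ 2 -> dot x x = 1 ->
    b * (r ^+ 2 - dist2 c q) ^+ k.+2 + mu <= bil (G q) x x) ->
  dist2 c p < r ^+ 2 -> dot xi xi = 1 ->
  bil (G p) xi xi = b * (r ^+ 2 - dist2 c p) ^+ k.+2 + mu ->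
  let X := r ^+ 2 - dist2 c p in
  touching p xi (bil (G p) xi xi)
    (fun y => b * (k.+2%:R * X ^+ k.+1 * (- (2 * ip (p - c) y))))
    (fun y => b * (k.+2%:R * X ^+ k.+1 * (- ip y y)
       + k.+2%:R * k.+1%:R / 2 * X ^+ k * (- (2 * ip (p - c) y)) ^+ 2)).
Proof.
move=> Up Hmin pr xi1 mE X.
have key y eta :
  bil (dG p y) xi xi + bil (G p) xi eta + bil (G p) eta xi =
   b * (k.+2%:R * X ^+ k.+1 * (- (2 * ip (p - c) y))) + 2 * bil (G p) xi xi * dot xi eta /\
  b * (k.+2%:R * X ^+ k.+1 * (- ip y y)
       + k.+2%:R * k.+1%:R / 2 * X ^+ k * (- (2 * ip (p - c) y)) ^+ 2)
  + 2 * (b * (k.+2%:R * X ^+ k.+1 * (- (2 * ip (p - c) y)))) * dot xi eta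
  + bil (G p) xi xi * dot eta eta
  <= bil (d2G p y) xi xi + bil (dG p y) xi eta + bil (dG p y) eta xi + bil (G p) eta eta.
  have X0 : 0 < X by rewrite subr_gt0.
  (* For |s| <= 1 and |s| <= X / (2 M) the point p + s y stays in the ball where [Hmin] applies. *)
  pose M := `|2 * ip (p - c) y| + ip y y + 1.
  have M0 : 0 < M by rewrite ltr_wpDl// addr_ge0// ip_ge0.
  have XM : 0 < X / M / 2 by rewrite !divr_gt0.
  have JG := jet2_bil xi eta (fun i j => @G_jet p y i j Up).
  have JX := jet2X k (jet2_quad X (- (2 * ip (p - c) y)) (- ip y y)).
  have JX' := jet2D (jet2Z b JX) (jet2_cst mu).
  (* The vector xi + s eta is not a unit vector, so by homogeneity the barrier is compared after
     multiplication by |xi + s eta|^2. *)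
  have Jd := jet2_quad (1 : R) (2 * dot xi eta) (dot eta eta).
  have := jet2D JG (jet2N (jet2M JX' Jd)).
  rewrite -mE !addr0 mulr1 subrr => /jet2_ge0[].
    near=> s.
    have ds : r ^+ 2 - dist2 c (p + s *: y) = X + - (2 * ip (p - c) y) * s + - ip y y * s ^+ 2.
      by rewrite dist2_line /X; ring.
    have de : dot (xi + s *: eta) (xi + s *: eta) = 1 + 2 * dot xi eta * s + dot eta eta * s ^+ 2.
      by rewrite /dot !bilL (bilC eta xi (trmx1 R n)) -[bil _ xi xi]/(dot xi xi) xi1; ring.
    rewrite subr_ge0 -ds -de.
    apply: bil_ge_unit => x x1; apply: Hmin => //.
    have : X + - (2 * ip (p - c) y) * s + - ip y y * s ^+ 2 > 0.
      have s1 : `|s| <= 1 by near: s; exact: near0_le.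
      have s2 : `|s| <= X / M / 2 by near: s; exact: near0_le.
      have h1 : 2 * ip (p - c) y * s <= `|2 * ip (p - c) y| * `|s| by apply: le_trans (ler_norm _) _; rewrite (normrM (2 * ip (p - c) y)).
      have h2 : ip y y * s ^+ 2 <= ip y y * `|s|.
        rewrite ler_wpM2l ?ip_ge0// -(real_normK (num_real s)) expr2.
        by rewrite ler_piMl.
      have h3 : M * `|s| <= X / 2.
        by have := ler_wpM2l (ltW M0) s2; rewrite (_ : M * (X / M / 2) = X / 2); [|field; exact: lt0r_neq0].
      have : M * `|s| = `|2 * ip (p - c) y| * `|s| + ip y y * `|s| + `|s| by rewrite /M; ring.
      have := normr_ge0 s; lra.
    by rewrite -ds subr_gt0 => /ltW.
  move=> e1 e2; split; first by apply/eqP; rewrite -subr_eq0 -[X in _ == X]e1; apply/eqP; ring.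
  by rewrite -subr_ge0; apply: le_trans e2 _; rewrite le_eqVlt; apply/orP; left; apply/eqP; ring.
split => // [eta|y eta|y eta]; try by have [] := key y eta.
by apply: bil_ge_unit => x x1; rewrite mE; apply: Hmin => //; exact: ltW.
Unshelve. all: by end_near. Qed.

(** Minimize the form minus the barrier over the closed ball times the unit sphere. A negative
    minimum can be neither near c, where the barrier is at most [c0], nor on the boundary, where it
    vanishes; in the ring between, touching contradicts [supersol] for the chosen k. *)
Theorem positivity_propagates :
  (forall xi, dot xi xi = 1 -> 0 < bil (G c) xi xi) ->
  forall p xi, dist2 c p < r ^+ 2 -> dot xi xi = 1 -> 0 < bil (G p) xi xi.
Proof.
move=> Gc p0 xi0 p0r xi01.
have r2 : 0 < r ^+ 2 by rewrite exprn_gt0.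
have Uc : U c by apply: ball_sub; rewrite dist2xx ltW.
have [c0 c00 [s s0 Hs]] := posdef_near Uc Gc.
have s2 : 0 < s ^+ 2 by rewrite exprn_gt0.
(* Divided by (k + 2) b X^k, the inequality at a touching point will yield 2 (k + 1) E <= D, with D
   independent of k. Since s^2 <= C1 E in the ring, 2 (k + 1) s^2 > D C1 is contradictory. *)
pose D := r ^+ 2 * C2 + 2 * C * (r ^+ 2 * C3) + C * r ^+ 4.
have [k kP] : exists k : nat, D * C1 / (2 * s ^+ 2) < k.+1%:R.
  exists (Num.truncn (D * C1 / (2 * s ^+ 2))).
  by apply: truncnS_gt.
(* The barrier then has maximum [c0], the lower bound of the form on the ball of radius s. *)
pose b := c0 / (r ^+ 2) ^+ k.+2.
have b0 : 0 < b by rewrite divr_gt0// exprn_gt0.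
pose f (z : P * 'rV[R]_n) := bil (G z.1) z.2 z.2 - b * (r ^+ 2 - dist2 c z.1) ^+ k.+2.
pose K := [set p : P | dist2 c p <= r ^+ 2] `*` [set x : 'rV[R]_n | dot x x = 1].
have cK : compact K by apply: compact_setX; [apply: ball_compact; exact: ltW | exact: sphere_compact].
have K0 : K !=set0 by exists (p0, xi0); split => //=; exact: ltW.
have cf : {within K, continuous f}.
  apply: continuous_in_subspaceT => -[p xi]; rewrite inE => -[/= pr _].
  have cB := @bil_cont p xi (ball_sub pr).
  have cd : {for (p, xi), continuous (fun z : P * 'rV[R]_n => dist2 c z.1)}.
    apply: (@for_continuous_comp _ _ _ _ (dist2 c)); [exact: fst_cont | exact: dist2_cont].
  have cX := @for_continuousX _ _ _ _ k.+2 (for_continuousD (@for_continuous_cst R _ (r ^+ 2) _) (for_continuousN cd)).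
  exact: (for_continuousD cB (for_continuousN (for_continuousM (@for_continuous_cst R _ b _) cX))).
have [[p xi] + fmin] := compact_EVT_min K0 cK cf.
rewrite inE => -[/= pr xi1].
have psi0 q : dist2 c q <= r ^+ 2 -> 0 <= (r ^+ 2 - dist2 c q) ^+ k.+2.
  by move=> qr; rewrite exprn_ge0// subr_ge0.
have Up := ball_sub pr.
have [f0|f0] := leP 0 (f (p, xi)).
  have := fmin (p0, xi0); rewrite inE => /(_ (conj (ltW p0r) xi01)) f1.
  have := le_trans f0 f1; rewrite /f /= subr_ge0; apply: lt_le_trans.
  by rewrite mulr_gt0// exprn_gt0// subr_gt0.
exfalso.
have G0 : 0 <= bil (G p) xi xi by exact: G_psd.
have pr' : dist2 c p < r ^+ 2.
  rewrite lt_neqAle pr andbT; apply/eqP => E; move: f0.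
  by rewrite /f /= E subrr expr0n /= mulr0 subr0 ltNge G0.
have sp : s ^+ 2 <= dist2 c p.
  rewrite leNgt; apply/negP => /Hs/(_ xi1) c0G; move: f0; rewrite /f /= ltNge.
  rewrite subr_ge0 (le_trans _ c0G)// /b mulrAC ler_pdivrMr ?exprn_gt0//.
  rewrite ler_wpM2l ?(ltW c00)//; rewrite lerXn2r ?nnegrE ?subr_ge0 ?(ltW r2)//.
  by rewrite gerBl ip_ge0.
set X := r ^+ 2 - dist2 c p.
have X0 : 0 < X by rewrite subr_gt0.
have Xr : X <= r ^+ 2 by rewrite /X gerBl ip_ge0.
(* Shifted by the negative minimum of [f], the barrier touches the least eigenvalue at p. The value
   there is nonnegative and below the unshifted barrier, which makes the zero order term of
   [supersol] harmless. *)
have T := @touching_barrier p xi b (f (p, xi)) k Up.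
have {T} : touching p xi (bil (G p) xi xi)
    (fun y => b * (k.+2%:R * X ^+ k.+1 * (- (2 * ip (p - c) y))))
    (fun y => b * (k.+2%:R * X ^+ k.+1 * (- ip y y)
       + k.+2%:R * k.+1%:R / 2 * X ^+ k * (- (2 * ip (p - c) y)) ^+ 2)).
  apply: T => //; last by rewrite /f /= addrC subrK.
  move=> q x qr x1; have := fmin (q, x); rewrite inE => /(_ (conj qr x1)).
  by rewrite [X in _ <= X -> _]/f /=; lra.
move=> T.
have bk : 0 <= b * k.+2%:R * X ^+ k.+1 by apply: mulr_ge0; [apply: mulr_ge0; [exact: ltW | exact: ler0n] | apply: exprn_ge0; exact: ltW].
have S : \sum_j om j * (b * (k.+2%:R * X ^+ k.+1 * (- ip (Y j p) (Y j p))
       + k.+2%:R * k.+1%:R / 2 * X ^+ k * (- (2 * ip (p - c) (Y j p))) ^+ 2))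
   <= C * (2 * (b * k.+2%:R * X ^+ k.+1) * C3 + bil (G p) xi xi).
  apply: (supersol pr G0 T) => j.
  rewrite (_ : b * _ = - (2 * (b * k.+2%:R * X ^+ k.+1) * ip (p - c) (Y j p))); last by ring.
  have bk2 : 0 <= 2 * (b * k.+2%:R * X ^+ k.+1) by rewrite pmulr_rge0.
  by rewrite normrN (normrM (2 * _)) (ger0_norm bk2); apply: ler_wpM2l => //; exact: Y_bound1.
pose E := \sum_j om j * ip (p - c) (Y j p) ^+ 2.
pose F := \sum_j om j * ip (Y j p) (Y j p).
have Sum : \sum_j om j * (b * (k.+2%:R * X ^+ k.+1 * (- ip (Y j p) (Y j p))
       + k.+2%:R * k.+1%:R / 2 * X ^+ k * (- (2 * ip (p - c) (Y j p))) ^+ 2))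
   = b * k.+2%:R * X ^+ k * (2 * k.+1%:R * E - X * F).
  rewrite /E /F !mulr_sumr -sumrB mulr_sumr; apply: eq_bigr => j _.
  by rewrite exprS; field.
rewrite Sum in S.
have Gle : bil (G p) xi xi <= b * X ^+ k * X ^+ 2.
  by move: f0; rewrite /f /= -/X subr_lt0 => /ltW; rewrite -mulrA -exprD addn2.
have bX : 0 < b * X ^+ k by rewrite mulr_gt0// exprn_gt0.
have {}S : k.+2%:R * (2 * k.+1%:R * E - X * F) <= C * (2 * k.+2%:R * X * C3 + X ^+ 2).
  rewrite -(ler_pM2l bX); apply: le_trans (_ : C * (2 * (b * k.+2%:R * X ^+ k.+1) * C3 + b * X ^+ k * X ^+ 2) <= _).
    apply: le_trans (_ : C * (2 * (b * k.+2%:R * X ^+ k.+1) * C3 + bil (G p) xi xi) <= _).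
      by apply: le_trans S; rewrite le_eqVlt; apply/orP; left; apply/eqP; ring.
    by rewrite ler_wpM2l// lerD2l.
  by rewrite le_eqVlt; apply/orP; left; apply/eqP; rewrite exprS; ring.
have Fle : F <= C2 by exact: Y_bound2.
have Ele : s ^+ 2 <= C1 * E by apply: le_trans sp _; exact: elliptic.
have k1 : 1 <= k.+2%:R :> R by rewrite ler1n.
have Xsq : X ^+ 2 <= r ^+ 4.
  rewrite (_ : r ^+ 4 = (r ^+ 2) ^+ 2); last by rewrite -exprM.
  by apply: lerXn2r => //; rewrite nnegrE; exact: ltW.
have XF : X * F <= r ^+ 2 * C2.
  by apply: le_trans (_ : X * C2 <= _); [apply: ler_wpM2l => //; exact: ltW | exact: ler_wpM2r].
have S2 : C * (2 * k.+2%:R * X * C3 + X ^+ 2) <= k.+2%:R * (2 * C * (r ^+ 2 * C3) + C * r ^+ 4).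
  have a1 : C * (X * C3) <= C * (r ^+ 2 * C3) by apply: ler_wpM2l => //; exact: ler_wpM2r.
  have a2 : C * X ^+ 2 <= k.+2%:R * (C * r ^+ 4).
    apply: le_trans (_ : C * r ^+ 4 <= _); first by rewrite ler_wpM2l.
    by rewrite ler_peMl// mulr_ge0// exprn_ge0// ltW.
  have := ler_wpM2l (ler0n R k.+2) a1.
  have -> : C * (2 * k.+2%:R * X * C3 + X ^+ 2) = 2 * (k.+2%:R * (C * (X * C3))) + C * X ^+ 2 by ring.
  have -> : k.+2%:R * (2 * C * (r ^+ 2 * C3) + C * r ^+ 4) = 2 * (k.+2%:R * (C * (r ^+ 2 * C3))) + k.+2%:R * (C * r ^+ 4) by ring.
  lra.
have : 2 * k.+1%:R * E <= D.
  have k2 : 0 < k.+2%:R :> R by rewrite ltr0n.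
  have := le_trans S S2; rewrite ler_pM2l// /D; lra.
move=> DE.
have : 2 * k.+1%:R * s ^+ 2 <= D * C1.
  apply: le_trans (_ : C1 * (2 * k.+1%:R * E) <= _); last by rewrite mulrC ler_wpM2r ?(ltW C1_gt0).
  rewrite (_ : C1 * _ = 2 * k.+1%:R * (C1 * E)); last by ring.
  by rewrite ler_wpM2l// mulr_ge0.
rewrite leNgt => /negP; apply.
by move: kP; rewrite ltr_pdivrMr ?mulr_gt0//; rewrite (_ : k.+1%:R * _ = 2 * k.+1%:R * s ^+ 2) //; ring.
Qed.

End StrongMinimumPrinciple.

(** * Local bounds *)

Section Bounds.
Variables (R : realType) (n : nat) (U : set ('rV[R]_n * R)) (eps : R).
Variable u : 'rV[R]_n * R -> R.
Hypotheses (U_open : open U) (eps_gt0 : 0 < eps) (u_smooth : smooth_on U u).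
Hypothesis u_eq : forall p, U p -> donaldson eps u p.
Hypothesis u_psd : forall p, U p -> psd (hessian u p + 1%:M).
Variables (c : 'rV[R]_n * R) (r : R).
Hypotheses (r_gt0 : 0 < r) (ball_sub : forall p, dist2 c p <= r ^+ 2 -> U p).
Local Notation P := ('rV[R]_n * R)%type.
Implicit Types (f g : P -> 'rV[R]_n -> R).

(** Quantities depending on p alone are treated as constant in xi. When n = 0 no unit vector exists
    and [bdd] says nothing, whence the [noxi] branches below. *)
Definition bdd f := exists M : R, forall p xi,
  dist2 c p <= r ^+ 2 -> dot xi xi = 1 -> `|f p xi| <= M.

Lemma eq_bdd f g : (forall p xi, f p xi = g p xi) -> bdd f -> bdd g.
Proof. by move=> fg [M H]; exists M => p xi pr x1; rewrite -fg; exact: H. Qed.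

Lemma bdd_cst (a : R) : bdd (fun _ _ => a).
Proof. by exists `|a|. Qed.

Lemma bddD f g : bdd f -> bdd g -> bdd (fun p xi => f p xi + g p xi).
Proof.
move=> [M H] [N H']; exists (M + N) => p xi pr x1.
apply: le_trans (ler_normD _ _) _; apply: lerD; [exact: H | exact: H'].
Qed.

Lemma bddM f g : bdd f -> bdd g -> bdd (fun p xi => f p xi * g p xi).
Proof.
move=> [M H] [N H']; exists (M * N) => p xi pr x1.
by rewrite normrM; apply: ler_pM => //; [exact: H | exact: H'].
Qed.

Lemma bddN f : bdd f -> bdd (fun p xi => - f p xi).
Proof. by move=> [M H]; exists M => p xi pr x1; rewrite normrN; exact: H. Qed.

Lemma bdd_sum (I : Type) (s : seq I) (f : I -> P -> 'rV[R]_n -> R) :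
  (forall i, bdd (f i)) -> bdd (fun p xi => \sum_(i <- s) f i p xi).
Proof.
move=> bf; elim: s => [|i s IH].
  by apply: eq_bdd (bdd_cst 0) => p xi; rewrite big_nil.
by apply: eq_bdd (bddD (bf i) IH) => p xi; rewrite big_cons.
Qed.

Lemma bdd_fin (I : finType) (f : I -> P -> 'rV[R]_n -> R) :
  (forall i, bdd (f i)) -> exists2 M : R, 0 <= M & forall i p xi,
  dist2 c p <= r ^+ 2 -> dot xi xi = 1 -> `|f i p xi| <= M.
Proof.
move=> bf.
have bfn i : bdd (fun p xi => `|f i p xi|).
  by have [M H] := bf i; exists M => p xi pr x1; rewrite normr_id; exact: H.
have [M H] := bdd_sum (index_enum I) bfn.
exists `|M| => // i p xi pr x1; apply: le_trans (_ : \sum_j `|f j p xi| <= _).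
  by rewrite (bigD1 i)//= lerDl sumr_ge0.
apply: le_trans (ler_norm _) (le_trans (H p xi pr x1) (ler_norm _)).
Qed.

Lemma bdd_pd s : bdd (fun p _ => pd u s p).
Proof.
have cf : {within [set p | dist2 c p <= r ^+ 2], continuous (pd u s)}.
  apply: continuous_in_subspaceT => p; rewrite inE /= => pr.
  rewrite unlock; exact: smooth_cont (smooth_partials s u_smooth) (ball_sub pr).
have := compact_bounded (continuous_compact cf (@ball_compact R n c r (ltW r_gt0))).
move=> [M [_ HM]]; exists (M + 1) => p xi pr _.
by apply: (HM (M + 1)); [rewrite ltrDl | exists p].
Qed.

Lemma bdd_coord i : bdd (fun _ xi => xi 0 i).
Proof. by exists 1 => p xi _; exact: unit_coord. Qed.

Lemma bdd_trace : bdd (fun p _ => \tr (Wm u p)).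
Proof.
apply: (@eq_bdd (fun p _ => n%:R + \sum_j pd u [:: Some j; Some j] p)).
  by move=> p xi; rewrite trace_Wm.
by apply: bddD (bdd_cst _) _; apply: bdd_sum => j; exact: bdd_pd.
Qed.

(** The equation keeps tr W away from 0: utt tr W >= eps, and utt is bounded on the ball. *)
Lemma bdd_inv_trace : bdd (fun p _ => (\tr (Wm u p))^-1).
Proof.
have [M H] := bdd_pd [:: None; None].
exists (M / eps) => p xi pr x1.
have Up := ball_sub pr.
have t0 := trace_Wm_gt0 eps_gt0 u_eq u_psd Up.
rewrite gtr0_norm ?invr_gt0// ler_pdivlMr// mulrC ler_pdivrMr//.
apply: le_trans (_ : utt u p * \tr (Wm u p) <= _).
  by rewrite (donaldson_eq u_eq Up) lerDl dot_ge0.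
rewrite ler_wpM2r ?(ltW t0)//; apply: le_trans (ler_norm _) (H p xi pr x1).
Qed.

Lemma bdd_gradt j : bdd (fun p _ => gradt u p 0 j).
Proof. by apply: eq_bdd (bdd_pd [:: None; Some j]) => p xi; rewrite mxE. Qed.

Lemma bdd_thirdt k : bdd (fun p xi => thirdt u p xi 0 k).
Proof.
apply: (@eq_bdd (fun p xi => \sum_l xi 0 l * pd u [:: None; Some k; Some l] p)).
  by move=> p xi; rewrite mxE.
by apply: bdd_sum => l; apply: bddM; [exact: bdd_coord | exact: bdd_pd].
Qed.

Lemma bdd_tau : bdd (fun p xi => tau u p xi).
Proof.
apply: bddM bdd_inv_trace.
apply: (@eq_bdd (fun p xi => \sum_j \sum_l xi 0 l * pd u [:: Some j; Some j; Some l] p)).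
  by move=> p xi; apply: eq_bigr => j _; rewrite mxE.
apply: bdd_sum => j; apply: bdd_sum => l.
by apply: bddM; [exact: bdd_coord | exact: bdd_pd].
Qed.

Lemma bdd_etav a i : bdd (fun p xi => etav u p xi a 0 i).
Proof.
case: a => [j|].
  pose f p xi := - (utt u p * tau u p xi - (\tr (Wm u p))^-1 * \sum_k thirdt u p xi 0 k * gradt u p 0 k)
     * ((i == j)%:R) + (\tr (Wm u p))^-1 * (gradt u p 0 j * thirdt u p xi 0 i - thirdt u p xi 0 j * gradt u p 0 i).
  apply: (@eq_bdd f) => [p xi|].
    by rewrite /f /= /eta_x dotE !mxE eqxx.
  apply: bddD; apply: bddM.
  - apply: bddN; apply: bddD.
      by apply: bddM; [exact: bdd_pd | exact: bdd_tau].
    apply: bddN; apply: bddM; first exact: bdd_inv_trace.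
    by apply: bdd_sum => k; apply: bddM; [exact: bdd_thirdt | exact: bdd_gradt].
  - exact: bdd_cst.
  - exact: bdd_inv_trace.
  - apply: bddD; first by apply: bddM; [exact: bdd_gradt | exact: bdd_thirdt].
    by apply: bddN; apply: bddM; [exact: bdd_thirdt | exact: bdd_gradt].
apply: (@eq_bdd (fun p xi => - (\tr (Wm u p))^-1 * thirdt u p xi 0 i)).
  by move=> p xi; rewrite /= /eta_t !mxE.
by apply: bddM; [apply: bddN; exact: bdd_inv_trace | exact: bdd_thirdt].
Qed.

Lemma dot_etav_bound : exists2 M : R, 0 <= M & forall p xi zeta a,
  dist2 c p <= r ^+ 2 -> dot xi xi = 1 -> dot zeta zeta = 1 ->
  `|dot zeta (etav u p xi a)| <= M.
Proof.
have [M M0 H] := bdd_fin (fun ai : option 'I_n * 'I_n => bdd_etav ai.1 ai.2).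
exists (\sum_(i < n) M); first exact: sumr_ge0.
move=> p xi zeta a pr x1 z1; rewrite dotE.
apply: le_trans (ler_norm_sum _ _ _) _; apply: ler_sum => i _.
rewrite normrM -[M]mul1r; apply: ler_pM => //; first exact: unit_coord.
exact: (H (a, i)).
Qed.

Lemma om_sum_ge0 : 0 <= \sum_(a : option 'I_n) om eps a :> R.
Proof. by apply: sumr_ge0 => a _; exact: om_ge0. Qed.

Lemma Yv_bound2 : exists2 C : R, 0 <= C & forall p, dist2 c p <= r ^+ 2 ->
  \sum_a om eps a * ip (Yv u p a) (Yv u p a) <= C.
Proof.
have b : bdd (fun p _ => \sum_a om eps a * ip (Yv u p a) (Yv u p a)).
  apply: bdd_sum => a; apply: bddM; first exact: bdd_cst.
  case: a => [j|].
    apply: (@eq_bdd (fun p _ => utt u p * utt u p + gradt u p 0 j * gradt u p 0 j)).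
      move=> p xi; rewrite /ip /dot /= !bilL bil_delta [1%:M j j]mxE eqxx mulr1n; ring.
    apply: bddD; apply: bddM; try exact: bdd_gradt; exact: bdd_pd.
  apply: (@eq_bdd (fun _ _ => 1)) => [p xi|]; last exact: bdd_cst.
  by rewrite /ip /dot /= bil0l add0r mulr1.
have [[xi0 x01]|noxi] := pselect (exists xi : 'rV[R]_n, dot xi xi = 1).
  have [C H] := b; exists `|C| => // p pr.
  apply: le_trans (ler_norm _) (le_trans (H p xi0 pr x01) (ler_norm _)).
exists (\sum_(a : option 'I_n) om eps a); first exact: om_sum_ge0.
move=> p pr; apply: ler_sum => -[j|] _ /=; last first.
  by rewrite /ip /dot /= bil0l add0r !mulr1.
case: noxi; exists (delta_mx 0 j); by rewrite /dot bil_delta mxE eqxx.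
Qed.

Lemma Yv_bound1 : exists2 C : R, 0 <= C & forall p a, dist2 c p <= r ^+ 2 ->
  `|ip (p - c) (Yv u p a)| <= C.
Proof.
have cx p i : dist2 c p <= r ^+ 2 -> `|(p - c).1 0 i| <= r.
  move=> pr; rewrite ler_norml; apply: (sqr_le_itv (ltW r_gt0)); apply: le_trans pr.
  by rewrite /dist2 /ip; apply: le_trans (sum_sqr_le _ i) _; rewrite lerDl -expr2 sqr_ge0.
have ct p : dist2 c p <= r ^+ 2 -> `|(p - c).2| <= r.
  move=> pr; rewrite ler_norml; apply: (sqr_le_itv (ltW r_gt0)); apply: le_trans pr.
  by rewrite /dist2 /ip -expr2 lerDr dot_ge0.
have b a : bdd (fun p _ => ip (p - c) (Yv u p a)).
  case: a => [j|].
    apply: (@eq_bdd (fun p _ => utt u p * (p - c).1 0 j + (p - c).2 * - gradt u p 0 j)).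
      by move=> p xi; rewrite /ip /= -dot_delta /dot -bilZr.
    apply: bddD; apply: bddM.
    - exact: bdd_pd.
    - by exists r => p xi pr _; exact: cx.
    - by exists r => p xi pr _; exact: ct.
    - by apply: bddN; exact: bdd_gradt.
  exists r => p xi pr _; rewrite /ip /dot /= bil0r add0r mulr1; exact: ct.
have [[xi0 x01]|noxi] := pselect (exists xi : 'rV[R]_n, dot xi xi = 1).
  have [C C0 H] := bdd_fin b; exists C => // p a pr; exact: H pr x01.
exists r; first exact: ltW.
move=> p [j|] pr; last by rewrite /ip /dot /= bil0r add0r mulr1; exact: ct.
case: noxi; exists (delta_mx 0 j); by rewrite /dot bil_delta mxE eqxx.
Qed.

(** For p - c = (x, t) and w = T x - t g the sum is E = |w|^2 + eps t^2. It controls t, hence T x =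
    w + t g, hence x because T^-1 <= s / eps; with |g|^2 <= T s this gives the constant 4 s^2 /
    eps^2 + 1 / eps. *)
Lemma Yv_elliptic : exists2 C : R, 0 < C & forall p, dist2 c p <= r ^+ 2 ->
  dist2 c p <= C * \sum_a om eps a * ip (p - c) (Yv u p a) ^+ 2.
Proof.
have ell p : U p ->
    dist2 c p <= (4 * \tr (Wm u p) ^+ 2 / eps ^+ 2 + eps^-1) * \sum_a om eps a * ip (p - c) (Yv u p a) ^+ 2.
  move=> Up; set s := \tr (Wm u p); rewrite /dist2; move: (p - c) => [x t].
  have s0 : 0 < s := trace_Wm_gt0 eps_gt0 u_eq u_psd Up.
  have TE : utt u p * s = eps + dot (gradt u p) (gradt u p) := donaldson_eq u_eq Up.
  set T := utt u p in TE *; set g := gradt u p in TE *.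
  have g0 := dot_ge0 g.
  have T0 : 0 < T by rewrite -(pmulr_lgt0 _ s0) TE ltr_pwDl.
  pose w := T *: x - t *: g.
  have -> : \sum_a om eps a * ip (x, t) (Yv u p a) ^+ 2 = dot w w + eps * t ^+ 2.
    rewrite sum_option addrC /=; congr (_ + _); last by rewrite /ip /dot /= bil0r add0r mulr1.
    rewrite dotE; apply: eq_bigr => j _; rewrite mul1r /ip /= -/T -/g /w !mxE.
    by rewrite /dot bilZr -/(dot _ _) dot_delta; ring.
  rewrite /ip /=.
  have w0 := dot_ge0 w.
  have key : T ^+ 2 * dot x x <= 2 * dot w w + 2 * (t ^+ 2 * dot g g).
    have xE : T *: x = w + t *: g by rewrite /w subrK.
    have : 0 <= dot (w - t *: g) (w - t *: g) by exact: dot_ge0.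
    have : dot (T *: x) (T *: x) = T ^+ 2 * dot x x by rewrite dotZZ.
    rewrite xE /dot !bilL; lra.
  have gT : dot g g <= T * s by rewrite TE lerDr ltW.
  have sT : eps <= T * s by rewrite TE lerDl.
  have i1 : T^-1 <= s / eps by rewrite ler_pdivlMr// mulrC ler_pdivrMr// mulrC.
  have tt : 0 <= t ^+ 2 by exact: sqr_ge0.
  set E := dot w w + eps * t ^+ 2.
  have Ew : dot w w <= E by rewrite /E lerDl mulr_ge0// ltW.
  have Et : t ^+ 2 <= E / eps by rewrite ler_pdivlMr// mulrC /E lerDr.
  have E0 : 0 <= E by exact: le_trans Ew.
  have Ti0 : 0 <= T^-1 by rewrite invr_ge0 ltW.
  have i2 : T^-1 ^+ 2 <= (s / eps) ^+ 2 by apply: lerXn2r => //; rewrite nnegrE// divr_ge0// ltW.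
  have se : 0 <= s / eps by rewrite divr_ge0// ltW.
  have X1 : dot x x <= T^-1 ^+ 2 * (2 * dot w w + 2 * (t ^+ 2 * (T * s))).
    have -> : dot x x = T^-1 ^+ 2 * (T ^+ 2 * dot x x) by field; exact: lt0r_neq0.
    apply: ler_wpM2l; first exact: sqr_ge0.
    apply: le_trans key _.
    by rewrite lerD2l ler_wpM2l// ler_wpM2l.
  have X2 : T^-1 ^+ 2 * (2 * dot w w) <= (s / eps) ^+ 2 * (2 * E).
    by apply: ler_pM => //; rewrite ?sqr_ge0 ?mulr_ge0 ?ler_wpM2l.
  have X3 : T^-1 ^+ 2 * (2 * (t ^+ 2 * (T * s))) <= 2 * s * (s / eps) * (E / eps).
    have -> : T^-1 ^+ 2 * (2 * (t ^+ 2 * (T * s))) = 2 * s * T^-1 * t ^+ 2.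
      by field; exact: lt0r_neq0.
    apply: ler_pM => //; first by rewrite !mulr_ge0// ltW.
    by apply: ler_wpM2l => //; rewrite mulr_ge0// ltW.
  have -> : (4 * s ^+ 2 / eps ^+ 2 + eps^-1) * E =
    (s / eps) ^+ 2 * (2 * E) + 2 * s * (s / eps) * (E / eps) + E / eps.
    by field; exact: lt0r_neq0.
  rewrite -expr2; move: X1; rewrite mulrDr; lra.
have [M H] := bdd_trace.
have [[xi0 x01]|noxi] := pselect (exists xi : 'rV[R]_n, dot xi xi = 1).
  exists (4 * M ^+ 2 / eps ^+ 2 + eps^-1).
    apply: ltr_wpDl; last by rewrite invr_gt0.
    by apply: divr_ge0; [apply: mulr_ge0 => //; exact: sqr_ge0 | exact: sqr_ge0].
  move=> p pr; have Up := ball_sub pr; apply: le_trans (ell p Up) _.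
  apply: ler_wpM2r.
    by apply: sumr_ge0 => a _; rewrite mulr_ge0 ?sqr_ge0 ?om_ge0.
  rewrite lerD2r ler_wpM2r ?invr_ge0 ?sqr_ge0// ler_wpM2l//.
  have := H p xi0 pr x01; have t0 := trace_Wm_gt0 eps_gt0 u_eq u_psd Up.
  rewrite gtr0_norm// => h; apply: lerXn2r => //; rewrite nnegrE; first exact: ltW.
  exact: le_trans (ltW t0) h.
exists (1 + eps^-1) => [|p pr]; first by rewrite ltr_wpDl// invr_gt0.
have Up := ball_sub pr.
have := ell p Up; rewrite /=; suff -> : \tr (Wm u p) = 0.
  rewrite expr0n /= mulr0 mul0r add0r => h; apply: le_trans h _.
  apply: ler_wpM2r; last by rewrite lerDr.
  by apply: sumr_ge0 => a _; rewrite mulr_ge0 ?sqr_ge0 ?om_ge0.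
rewrite /mxtrace big1// => j _; case: noxi; exists (delta_mx 0 j).
by rewrite /dot bil_delta mxE eqxx.
Qed.

End Bounds.

(** * Propagation of positivity *)

Section OrthonormalBasis.
Variables (R : realType) (n : nat) (E : 'I_n -> 'rV[R]_n).
Hypothesis E_on : forall i k, dot (E i) (E k) = (i == k)%:R.

Lemma onb_mul : (\matrix_i E i)^T *m (\matrix_i E i) = 1%:M.
Proof.
apply: mulmx1C; apply/matrixP => i k.
have -> : ((\matrix_i E i) *m (\matrix_i E i)^T) i k = dot (E i) (E k).
  by rewrite dotE mxE; apply: eq_bigr => j _; rewrite !mxE.
by rewrite E_on mxE.
Qed.

Lemma onb_trace (A : 'M[R]_n) : \tr A = \sum_i bil A (E i) (E i).
Proof.
rewrite -[A in LHS]mulmx1 -onb_mul mulmxA mxtrace_mulC mulmxA; apply: eq_bigr => i _.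
rewrite /bil [LHS]mxE [RHS]mxE; apply: eq_bigr => k _; rewrite !mxE; congr (_ * _).
by apply: eq_bigr => l _; rewrite !mxE.
Qed.

Lemma onb_expand (x : 'rV[R]_n) : x = \sum_i dot x (E i) *: E i.
Proof.
rewrite -[LHS]mulmx1 -onb_mul mulmxA mulmx_sum_row; apply: eq_bigr => i _.
rewrite rowK; congr (_ *: _); rewrite dotE mxE.
by apply: eq_bigr => k _; rewrite !mxE.
Qed.

End OrthonormalBasis.

Lemma exists_orthonormal_third (R : realType) (e1 e3 : 'rV[R]_3) :
  dot e1 e1 = 1 -> dot e3 e3 = 1 -> dot e1 e3 = 0 ->
  exists e2, [/\ dot e2 e2 = 1, dot e2 e1 = 0, dot e2 e3 = 0,
    forall A : 'M[R]_3, \tr A = bil A e1 e1 + bil A e2 e2 + bil A e3 e3 &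
    forall x : 'rV[R]_3, x = dot x e1 *: e1 + dot x e2 *: e2 + dot x e3 *: e3].
Proof.
move=> e11 e33 e13.
(* A 3 by 2 matrix has a nonzero left kernel, which is the space orthogonal to e1 and e3. *)
pose B : 'M[R]_(3, 1 + 1) := row_mx e1^T e3^T.
have [v v0 vB] : exists2 v : 'rV[R]_3, v != 0 & v *m B = 0.
  have : kermx B != 0.
    by rewrite kermx_eq0 /row_free neq_ltn ltnS (leq_trans (rank_leq_col B)).
  by move=> /rowV0Pn[v /sub_kermxP vB v0]; exists v.
have v1 : dot v e1 = 0.
  move: vB; rewrite /B mul_mx_row => /eqP; rewrite row_mx_eq0 => /andP[/eqP h _].
  by rewrite /dot /bil mulmx1 h mxE.
have v3 : dot v e3 = 0.
  move: vB; rewrite /B mul_mx_row => /eqP; rewrite row_mx_eq0 => /andP[_ /eqP h].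
  by rewrite /dot /bil mulmx1 h mxE.
have vv := dot_gt0 v0.
pose e2 := (Num.sqrt (dot v v))^-1 *: v.
have e22 : dot e2 e2 = 1.
  by rewrite /e2 dotZZ exprVn sqr_sqrtr ?ltW// mulVf// lt0r_neq0.
have e21 : dot e2 e1 = 0 by rewrite /e2 dotZl v1 mulr0.
have e23 : dot e2 e3 = 0 by rewrite /e2 dotZl v3 mulr0.
pose E (i : 'I_3) := nth 0 [:: e1; e2; e3] i.
have E_on i k : dot (E i) (E k) = (i == k)%:R.
  have e12 : dot e1 e2 = 0 by rewrite dotC.
  have e31 : dot e3 e1 = 0 by rewrite dotC.
  have e32 : dot e3 e2 = 0 by rewrite dotC.
  by case: i k => [[|[|[|]]] // ?] [[|[|[|]]] // ?]; rewrite /E.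
exists e2; split=> // [A|x].
  by rewrite (onb_trace E_on) !big_ord_recl big_ord0 addr0 addrA.
by rewrite {1}(onb_expand E_on x) !big_ord_recl big_ord0 addr0 addrA.
Qed.

Section Propagation.
Variables (R : realType) (n : nat) (U : set ('rV[R]_n * R)) (eps : R).
Variable u : 'rV[R]_n * R -> R.
Hypotheses (U_open : open U) (eps_gt0 : 0 < eps) (u_smooth : smooth_on U u).
Hypothesis u_eq : forall p, U p -> donaldson eps u p.
Hypothesis u_psd : forall p, U p -> psd (hessian u p + 1%:M).
Variables (c : 'rV[R]_n * R) (r : R).
Hypotheses (r_gt0 : 0 < r) (ball_sub : forall p, dist2 c p <= r ^+ 2 -> U p).

Lemma Wm_cont p i j : U p -> {for p, continuous (fun q => Wm u q i j)}.
Proof.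
move=> Up; rewrite (_ : (fun _ => _) = fun q => pd u [:: Some j; Some i] q + (i == j)%:R); last first.
  by apply/funext => q; rewrite WmE.
apply: for_continuousD; last exact: for_continuous_cst.
by rewrite unlock; exact: smooth_cont (smooth_partials _ u_smooth) Up.
Qed.

(** Taking eta = [etav] in the touching condition makes the weighted second variations sum to at
    most 0. The term m |eta|^2 has a good sign, and the only error is the cross term 2 q (xi . eta),
    at most 2 B M for each field. *)
Lemma Wm_supersolution : exists2 C : R, 0 <= C &
  forall p xi m q Q B, dist2 c p <= r ^+ 2 -> 0 <= m ->
  touching (Wm u) (dW u) (d2W u) p xi m q Q -> (forall a, `|q (Yv u p a)| <= B) ->
  \sum_a om eps a * Q (Yv u p a) <= C * (B + m).
Proof.
have [M M0 HM] := dot_etav_bound eps_gt0 u_smooth u_eq u_psd r_gt0 ball_sub.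
pose S : R := \sum_(a : option 'I_n) om eps a.
have S0 : 0 <= S by exact: om_sum_ge0.
exists (S * (2 * M)); first by rewrite !mulr_ge0.
move=> p xi m q Q B pr m0 [x1 mE _ _ E2] HB.
have Up := ball_sub pr.
have B0 : 0 <= B by exact: le_trans (normr_ge0 _) (HB None).
have Ta a : Q (Yv u p a) <= second_variation u p xi a (etav u p xi a) + 2 * (B * M).
  have := E2 (Yv u p a) (etav u p xi a).
  rewrite (bilC (etav u p xi a) xi (dW_sym U_open u_smooth (Yv u p a) Up)) /second_variation.
  have h : `|q (Yv u p a) * dot xi (etav u p xi a)| <= B * M.
    by rewrite normrM; apply: ler_pM => //; exact: HM.
  have := ler_norml (q (Yv u p a) * dot xi (etav u p xi a)) (B * M); rewrite h.
  move=> /esym/andP[h1 h2].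
  have : 0 <= m * dot (etav u p xi a) (etav u p xi a) by rewrite mulr_ge0// dot_ge0.
  rewrite -(mulrA 2 (q _)); lra.
apply: le_trans (_ : \sum_a (om eps a * second_variation u p xi a (etav u p xi a) + om eps a * (2 * (B * M))) <= _).
  by apply: ler_sum => a _; rewrite -mulrDr; apply: ler_wpM2l => //; exact: om_ge0.
rewrite big_split /= -mulr_suml -/S.
have := second_variation_le0 U_open eps_gt0 u_smooth u_eq u_psd xi Up.
have : S * (2 * (B * M)) <= S * (2 * M) * (B + m).
  have -> : S * (2 * M) * (B + m) = S * (2 * (B * M)) + S * (2 * M) * m by ring.
  by rewrite lerDl mulr_ge0// !mulr_ge0.
lra.
Qed.

Lemma propagation_of_supersolution (G : 'rV[R]_n * R -> 'M[R]_n)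
    (dG d2G : 'rV[R]_n * R -> 'rV[R]_n * R -> 'M[R]_n) :
  (forall p y i j, U p ->
     jet2 (fun s => G (p + s *: y) i j) (G p i j) (dG p y i j) (d2G p y i j)) ->
  (forall p i j, U p -> {for p, continuous (fun q => G q i j)}) ->
  (forall p, U p -> psd (G p)) ->
  (exists2 C : R, 0 <= C &
    forall p xi m q Q B, dist2 c p <= r ^+ 2 -> 0 <= m ->
    touching G dG d2G p xi m q Q -> (forall a, `|q (Yv u p a)| <= B) ->
    \sum_a om eps a * Q (Yv u p a) <= C * (B + m)) ->
  (forall xi, dot xi xi = 1 -> 0 < bil (G c) xi xi) ->
  forall p xi, dist2 c p < r ^+ 2 -> dot xi xi = 1 -> 0 < bil (G p) xi xi.
Proof.
move=> Gjet Gcont Gpsd [C C0 HC].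
have [C1 C10 H1] := Yv_elliptic eps_gt0 u_smooth u_eq u_psd r_gt0 ball_sub.
have [C2 C20 H2] := Yv_bound2 eps_gt0 u_smooth r_gt0 ball_sub.
have [C3 C30 H3] := Yv_bound1 u_smooth r_gt0 ball_sub.
exact: (@positivity_propagates R n U G dG d2G Gjet Gcont Gpsd _ (om eps)
  (fun a p => Yv u p a) c r C C1 C2 C3 r_gt0 ball_sub HC H1 H2 H3 C0 C10 C20 C30).
Qed.

Lemma Wm_propagation : (forall xi, dot xi xi = 1 -> 0 < bil (Wm u c) xi xi) ->
  forall p xi, dist2 c p < r ^+ 2 -> dot xi xi = 1 -> 0 < bil (Wm u p) xi xi.
Proof.
apply: (propagation_of_supersolution (dG := dW u) (d2G := d2W u)).
- by move=> p y i j; exact: jet2_Wm.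
- exact: Wm_cont.
- exact: u_psd.
- exact: Wm_supersolution.
Qed.

(** Being linear in A, it inherits the expansions of W, so that a sum of eigenvalues is covered by
    the principle for a least eigenvalue. *)
Definition cotrace (A : 'M[R]_n) : 'M[R]_n := (\tr A)%:M - A.

Lemma bil_cotrace A x y : bil (cotrace A) x y = \tr A * dot x y - bil A x y.
Proof. by rewrite /cotrace bilDm bilNm bil_scalar. Qed.

Lemma psd_cotrace A : psd A -> psd (cotrace A).
Proof. by move=> pA x; rewrite -/(bil _ _ _) bil_cotrace subr_ge0; exact: psd_le_trace. Qed.

Lemma jet2_cotrace p y i j : U p ->
  jet2 (fun s => cotrace (Wm u (p + s *: y)) i j) (cotrace (Wm u p) i j)
    (cotrace (dW u p y) i j) (cotrace (d2W u p y) i j).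
Proof.
move=> Up; have Jtr := jet2_sum (index_enum 'I_n) xpredT (fun k => jet2_Wm U_open u_smooth y k k Up).
have := jet2D (jet2M Jtr (jet2_cst (i == j)%:R)) (jet2N (jet2_Wm U_open u_smooth y i j Up)).
have E A : cotrace A i j = \sum_k A k k * (i == j)%:R - A i j.
  by rewrite /cotrace !mxE -mulr_suml mulr_natr.
move=> H; apply: (jet2_near _ (jet2_eq _ _ _ H)).
- by near=> s; rewrite E -mulr_suml.
- by rewrite E -mulr_suml.
- by rewrite E -mulr_suml; ring.
- by rewrite E -mulr_suml; ring.
Unshelve. all: by end_near. Qed.

Lemma cotrace_cont p i j : U p -> {for p, continuous (fun q => cotrace (Wm u q) i j)}.
Proof.
move=> Up; rewrite (_ : (fun _ => _) = fun q => (\sum_k Wm u q k k) * (i == j)%:R + - Wm u q i j); last first.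
  by apply/funext => q; rewrite /cotrace !mxE mulr_natr.
apply: for_continuousD; last by apply: for_continuousN; exact: Wm_cont.
apply: for_continuousM; last exact: for_continuous_cst.
by apply: for_continuous_sum => k; exact: Wm_cont.
Qed.

End Propagation.

(** * The sum of the two smallest eigenvalues in dimension 3 *)

Section SecondEigenvalue.
Variables (R : realType) (U : set ('rV[R]_3 * R)) (eps : R).
Variable u : 'rV[R]_3 * R -> R.
Hypotheses (U_open : open U) (eps_gt0 : 0 < eps) (u_smooth : smooth_on U u).
Hypothesis u_eq : forall p, U p -> donaldson eps u p.
Hypothesis u_psd : forall p, U p -> psd (hessian u p + 1%:M).
Hypothesis degenerate : forall p, U p -> exists2 e, dot e e = 1 & bil (Wm u p) e e = 0.
Variables (c : 'rV[R]_3 * R) (r : R).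
Hypotheses (r_gt0 : 0 < r) (ball_sub : forall p, dist2 c p <= r ^+ 2 -> U p).

(* xi is a top eigenvector of Wm u p; it is completed by a null vector e1 and by
   e2.  Moving xi by - (eta1 . xi) e1 - (eta2 . xi) e2 dualizes moving e1, e2 by
   eta1, eta2. *)
Lemma touching_cotrace p xi (m B M : R) q Q : U p -> 0 <= m -> 0 <= M ->
  touching (fun p => cotrace (Wm u p)) (fun p y => cotrace (dW u p y)) (fun p y => cotrace (d2W u p y)) p xi m q Q ->
  (forall a, `|q (Yv u p a)| <= B) ->
  (forall e e' a, dot e e = 1 -> dot e' e' = 1 -> `|dot e' (etav u p e a)| <= M) ->
  exists e1 e2, forall a, Q (Yv u p a) <= second_variation u p e1 a (etav u p e1 a)
    + second_variation u p e2 a (etav u p e2 a) + (4 * M ^+ 2 + 2 * M) * (B + m).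
Proof.
move=> Up m0 M0 [x1 /= mE G0 E1 E2] HB HM.
have sW := Wm_sym U_open u_smooth Up; have pW := u_psd Up.
have sdW y := dW_sym U_open u_smooth y Up.
have s0 := trace_Wm_gt0 eps_gt0 u_eq u_psd Up.
set s := \tr (Wm u p) in s0.
have B0 : 0 <= B by exact: le_trans (normr_ge0 _) (HB None).
have qE y : q y = \tr (dW u p y) - bil (dW u p y) xi xi.
  have := E1 y 0; rewrite /dot !bil0r !bil0l mulr0 !addr0 => <-.
  by rewrite bil_cotrace x1 mulr1.
(* Any direction would do: once [qE] is inserted, the first order condition says that xi is an
   eigenvector of W. *)
have Wx eta : bil (Wm u p) xi eta = (s - m) * dot xi eta.
  have := E1 (Yv u p None) eta; rewrite !bil_cotrace x1 mulr1 qE.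
  rewrite (bilC eta xi sW) (dotC eta xi) -/s; lra.
(* s - m is the top eigenvalue, so it bounds each of the three diagonal entries, whose sum s is
   positive. Being nonzero, it makes xi orthogonal to the null vector e1. *)
have l0 : 0 < s - m.
  have H i : Wm u p i i <= s - m.
    have d1 : dot (delta_mx 0 i) (delta_mx 0 i) = 1 :> R by rewrite dot_delta mxE !eqxx.
    have := G0 (delta_mx 0 i); rewrite bil_cotrace bil_delta d1 !mulr1 -/s; lra.
  have : s <= \sum_(i < 3) (s - m) by apply: ler_sum => i _; exact: H.
  by rewrite sumr_const card_ord; lra.
have [e1 e11 W11] := degenerate Up.
have We1 z : bil (Wm u p) e1 z = 0 by exact: psd_null_bil.
have e13 : dot e1 xi = 0.
  have := Wx e1; rewrite (bilC xi e1 sW) We1 => /esym/eqP; rewrite mulf_eq0 gt_eqF//= => /eqP.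
  by rewrite dotC.
have [e2 [e22 e21 e23 trE ex]] := exists_orthonormal_third e11 x1 e13.
have We2x : bil (Wm u p) e2 xi = 0 by rewrite (bilC e2 xi sW) Wx dotC e23 mulr0.
have Wxx : bil (Wm u p) xi xi = s - m by rewrite Wx x1 mulr1.
have W22 : bil (Wm u p) e2 e2 = m.
  by have := trE (Wm u p); rewrite -/s W11 Wxx; lra.
have W12 : bil (Wm u p) e2 e1 = 0 by rewrite (bilC e2 e1 sW) We1.
have We2 z : bil (Wm u p) e2 z = m * dot z e2.
  by rewrite {1}(ex z) !bilL W12 W22 We2x; ring.
exists e1, e2 => b.
set y := Yv u p b.
set h1 := etav u p e1 b; set h2 := etav u p e2 b.
have V1 z : bil (dW u p y) e1 z = - bil (Wm u p) h1 z.
  exact: (null_dW U_open eps_gt0 u_smooth u_eq u_psd z b Up W11).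
pose a11 := dot h1 e1; pose a12 := dot h1 e2; pose a13 := dot h1 xi.
pose a21 := dot h2 e1; pose a22 := dot h2 e2; pose a23 := dot h2 xi.
have V11 : bil (dW u p y) e1 e1 = 0 by rewrite V1 (bilC h1 e1 sW) We1 oppr0.
have V12 : bil (dW u p y) e1 e2 = - (m * a12) by rewrite V1 (bilC h1 e2 sW) We2.
have V22 : bil (dW u p y) e2 e2 = q y by rewrite qE (trE (dW u p y)) V11; ring.
have WW z : bil (Wm u p) z z = m * dot z e2 ^+ 2 + (s - m) * dot z xi ^+ 2.
  rewrite {1}(ex z) bilDl bilDl !bilZl We1 We2 Wx (dotC xi z); ring.
(* This displacement contributes 2 (a13 v13 + a23 v23), v13 and v23 being the entries of D W at (e1,
   xi) and (e2, xi). The two second variations contain the same amount, and their terms (s - m)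
   (a13^2 + a23^2) are matched as well. *)
have := E2 y (- (a13 *: e1 + a23 *: e2)).
rewrite !bil_cotrace x1 mulr1 /second_variation -/y -/h1 -/h2.
rewrite (trE (d2W u p y)) (WW h1) (WW h2).
have -> : dot xi (- (a13 *: e1 + a23 *: e2)) = 0.
  by rewrite dotC !dotL e13 e23; ring.
have -> : dot (- (a13 *: e1 + a23 *: e2)) xi = 0.
  by rewrite !dotL e13 e23; ring.
have -> : dot (- (a13 *: e1 + a23 *: e2)) (- (a13 *: e1 + a23 *: e2)) = a13 ^+ 2 + a23 ^+ 2.
  by rewrite !dotL e11 e22 e21 (dotC e1 e2) e21; ring.
have -> : bil (Wm u p) (- (a13 *: e1 + a23 *: e2)) (- (a13 *: e1 + a23 *: e2)) = m * a23 ^+ 2.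
  by rewrite WW !dotL e22 e13 e23 (dotC e1 e2) e21; ring.
have -> : bil (dW u p y) (- (a13 *: e1 + a23 *: e2)) xi = - (a13 * bil (dW u p y) e1 xi + a23 * bil (dW u p y) e2 xi).
  by rewrite !bilL; ring.
have -> : bil (dW u p y) xi (- (a13 *: e1 + a23 *: e2)) = - (a13 * bil (dW u p y) e1 xi + a23 * bil (dW u p y) e2 xi).
  by rewrite !bilL (bilC xi e1 (sdW y)) (bilC xi e2 (sdW y)); ring.
have -> : bil (dW u p y) e1 h1 = a12 * - (m * a12) + a13 * bil (dW u p y) e1 xi.
  by rewrite {1}(ex h1) !bilL V11 V12; rewrite -/a11 -/a12 -/a13; ring.
have -> : bil (dW u p y) e2 h2 = a21 * - (m * a12) + a22 * q y + a23 * bil (dW u p y) e2 xi.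
  by rewrite {1}(ex h2) !bilL V22 (bilC e2 e1 (sdW y)) V12; rewrite -/a21 -/a22 -/a23; ring.
rewrite -/a12 -/a13 -/a22 -/a23 -/s.
have b12 : `|a12| <= M by rewrite /a12 dotC; exact: HM.
have b21 : `|a21| <= M by rewrite /a21 dotC; exact: HM.
have b22 : `|a22| <= M by rewrite /a22 dotC; exact: HM.
have k1 : m * (a12 * a12) <= m * M ^+ 2.
  apply: ler_wpM2l => //; apply: le_trans (ler_norm _) _; rewrite normrM expr2; exact: ler_pM.
have k2 : m * (a21 * a12) <= m * M ^+ 2.
  apply: ler_wpM2l => //; apply: le_trans (ler_norm _) _; rewrite normrM expr2; exact: ler_pM.
have k3 : - (a22 * q y) <= M * B.
  apply: le_trans (ler_norm _) _; rewrite normrN normrM; apply: ler_pM => //; exact: HB.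
have k4 : 0 <= m * a23 ^+ 2 by rewrite mulr_ge0// sqr_ge0.
have k5 : 0 <= m * a12 ^+ 2 by rewrite mulr_ge0// sqr_ge0.
have k6 : 0 <= m * a22 ^+ 2 by rewrite mulr_ge0// sqr_ge0.
have k7 : 0 <= M ^+ 2 * B by rewrite mulr_ge0// sqr_ge0.
have k8 : 0 <= M * m by rewrite mulr_ge0.
(* Up to nonpositive terms the error left is 2 m a12^2 + 2 m a12 a21 - 2 a22 q, at most 4 m M^2 + 2
   M B. *)
have -> : (4 * M ^+ 2 + 2 * M) * (B + m) = 4 * (M ^+ 2 * B) + 4 * (m * M ^+ 2) + 2 * (M * B) + 2 * (M * m) by ring.
move: (bil _ e1 xi) (bil _ e2 xi) (bil _ e1 e1) (bil _ e2 e2) (bil _ xi xi) => v13 v23 t1 t2 t3 H.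
lra.
Qed.

Lemma cotrace_propagation :
  (forall xi, dot xi xi = 1 -> 0 < bil (cotrace (Wm u c)) xi xi) ->
  forall p xi, dist2 c p < r ^+ 2 -> dot xi xi = 1 -> 0 < bil (cotrace (Wm u p)) xi xi.
Proof.
apply: (propagation_of_supersolution eps_gt0 u_smooth u_eq u_psd r_gt0 ball_sub
  (G := fun p => cotrace (Wm u p)) (dG := fun p y => cotrace (dW u p y)) (d2G := fun p y => cotrace (d2W u p y))).
- by move=> p y i j; exact: jet2_cotrace.
- by move=> p i j; exact: cotrace_cont.
- by move=> p Up; apply: psd_cotrace; exact: u_psd.
have [M M0 HM] := dot_etav_bound eps_gt0 u_smooth u_eq u_psd r_gt0 ball_sub.
pose S : R := \sum_(a : option 'I_3) om eps a.
have S0 : 0 <= S by exact: om_sum_ge0.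
exists (S * (4 * M ^+ 2 + 2 * M)).
  by rewrite mulr_ge0// addr_ge0// mulr_ge0// sqr_ge0.
move=> p xi m q Q B pr m0 T HB; have Up := ball_sub pr.
have HMp e e' a : dot e e = 1 -> dot e' e' = 1 -> `|dot e' (etav u p e a)| <= M.
  by move=> h h'; exact: HM.
have [e1 [e2 H]] := touching_cotrace Up m0 M0 T HB HMp.
apply: le_trans (_ : \sum_a (om eps a * second_variation u p e1 a (etav u p e1 a)
  + om eps a * second_variation u p e2 a (etav u p e2 a) + om eps a * ((4 * M ^+ 2 + 2 * M) * (B + m))) <= _).
  by apply: ler_sum => a _; rewrite -!mulrDr; apply: ler_wpM2l; [exact: om_ge0 | exact: H].
rewrite !big_split /= -mulr_suml -/S.
have := second_variation_le0 U_open eps_gt0 u_smooth u_eq u_psd e1 Up.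
have := second_variation_le0 U_open eps_gt0 u_smooth u_eq u_psd e2 Up.
rewrite mulrA; lra.
Qed.

End SecondEigenvalue.

(** * Connectedness and ranks *)

Lemma connected_locally_constant (T : topologicalType) (A : set T) (S : T -> Prop) :
  connected A -> open A -> (forall x, A x -> \forall y \near x, S y <-> S x) ->
  forall x y, A x -> A y -> S x -> S y.
Proof.
move=> cA oA loc x y Ax Ay Sx.
have nA z : A z -> \forall w \near z, A w by move=> Az; apply: open_nbhs_nbhs; split.
have oS (Q : T -> Prop) : (forall x, A x -> \forall y \near x, Q y <-> Q x) ->
    open (A `&` [set z | Q z]).
  move=> locQ; rewrite openE => z [Az Qz].
  by apply: filterS (filterI (nA z Az) (locQ z Az)) => w [Aw Qw]; split => //; apply/Qw.
have oB := oS S loc.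
have oN : open (A `&` [set z | ~ S z]).
  apply: (oS (fun z => ~ S z)) => z Az; apply: filterS (loc z Az) => w H.
  by split => nS Sz; apply: nS; apply/H.
have BA : A `&` [set z | S z] = A.
  apply: cA.
  - by exists x.
  - by exists (A `&` [set z | S z]) => //; rewrite setIA setIid.
  - exists (~` (A `&` [set z | ~ S z])); first exact: open_closedC.
    apply/seteqP; split => z /=.
      by move=> [Az Sz]; split => // -[_].
    by move=> [Az H]; split => //; apply: contrapT => nS; apply: H.
have By : (A `&` [set z | S z]) y by rewrite BA.
by case: By.
Qed.

Lemma near_slicel (S T : topologicalType) (s : S) (t : T) (Q : S * T -> Prop) :
  (\forall z \near (s, t), Q z) -> \forall s' \near s, Q (s', t).
Proof.
case=> -[B C] /= [nB nC] BC; apply: filterS nB => s' Bs'.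
by apply: BC; split => //=; exact: nbhs_singleton.
Qed.

Lemma near_slicer (S T : topologicalType) (s : S) (t : T) (Q : S * T -> Prop) :
  (\forall z \near (s, t), Q z) -> \forall t' \near t, Q (s, t').
Proof.
case=> -[B C] /= [nB nC] BC; apply: filterS nC => t' Ct'.
by apply: BC; split => //=; exact: nbhs_singleton.
Qed.

(** The property is carried along the first factor and then along the second; slices of a locally
    constant predicate are locally constant. *)
Lemma setX_locally_constant (S T : topologicalType) (A : set S) (B : set T) (Q : S * T -> Prop) :
  connected A -> open A -> connected B -> open B ->
  (forall z, (A `*` B) z -> \forall w \near z, Q w <-> Q z) ->
  forall z w, (A `*` B) z -> (A `*` B) w -> Q z -> Q w.
Proof.
move=> cA oA cB oB loc [a b] [a' b'] [/= Aa Bb] [/= Aa' Bb'] Qab.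
have Qa'b : Q (a', b).
  apply: (connected_locally_constant (S := fun s => Q (s, b)) cA oA) Aa Aa' Qab => s As.
  by apply: (@near_slicel _ _ s b (fun w => Q w <-> Q (s, b))); exact: loc.
apply: (connected_locally_constant (S := fun t => Q (a', t)) cB oB) Bb Bb' Qa'b => t Bt.
by apply: (@near_slicer _ _ a' t (fun w => Q w <-> Q (a', t))); exact: loc.
Qed.

Lemma dist2_triangle (R : realType) (n : nat) (a b c : 'rV[R]_n * R) :
  dist2 a c <= 2 * dist2 a b + 2 * dist2 b c.
Proof.
rewrite /dist2; have -> : c - a = (b - a) + (c - b) by rewrite [RHS]addrC addrA subrK.
move: (b - a) (c - b) => [x s] [y t].
have : 0 <= dot (x - y) (x - y) by exact: dot_ge0.
have : 0 <= (s - t) ^+ 2 by exact: sqr_ge0.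
rewrite /ip /= !dotL (dotC y x) => h1 h2; nra.
Qed.

(** Propagation from p to a nearby q shows that S is open, and propagation from q back to p that it
    is closed. The radius e = r / 3 keeps the e-ball about q inside U, since 2 e^2 + 2 e^2 < 9 e^2 =
    r^2. *)
Lemma posdef_locally_constant (R : realType) (n : nat) (U : set ('rV[R]_n * R))
    (S : 'rV[R]_n * R -> Prop) : open U ->
  (forall c r, 0 < r -> (forall p, dist2 c p <= r ^+ 2 -> U p) -> S c ->
     forall p, dist2 c p < r ^+ 2 -> S p) ->
  forall p, U p -> \forall q \near p, S q <-> S p.
Proof.
move=> oU prop p Up.
have [r r0 rU] := dist2_nbhs (near_open oU Up).
pose e := r / 3; have e0 : 0 < e by rewrite divr_gt0.
have r9 : r ^+ 2 = 9 * e ^+ 2 by rewrite /e; field.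
have e2 : 0 < e ^+ 2 by rewrite exprn_gt0.
have := near_dist2 p e2; apply: filterS => q pq; split => Sq.
  apply: (prop q e e0) => //; last by rewrite dist2C.
  move=> z qz; apply: rU; have := dist2_triangle p q z; lra.
apply: (prop p e e0) => // z pz; apply: rU; lra.
Qed.

(** * Ranks of positive semidefinite matrices read off from their quadratic forms *)

Section Ranks.
Variables (R : realType) (n : nat).
Implicit Types (W : 'M[R]_n) (x : 'rV[R]_n).

Lemma unit_vector x : x != 0 -> exists k, dot (k *: x) (k *: x) = 1.
Proof.
move=> x0; have d0 := dot_gt0 x0; exists (Num.sqrt (dot x x))^-1.
by rewrite dotZZ exprVn sqr_sqrtr ?ltW// mulVf// lt0r_neq0.
Qed.

Lemma bil_eq0_mul W x : (forall z, bil W x z = 0) -> x *m W = 0.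
Proof.
move=> H; apply/rowP => i; rewrite [RHS]mxE -dot_delta.
by rewrite /dot /bil mulmx1; exact: H.
Qed.

Definition posdef W : Prop := forall x, dot x x = 1 -> 0 < bil W x x.

Lemma posdef_rank W : posdef W -> \rank W = n.
Proof.
move=> pW; apply/eqP; rewrite -[_ == _]/(row_free W) -kermx_eq0.
apply/negPn/negP => /rowV0Pn[v /sub_kermxP vW v0].
have [k kv] := unit_vector v0.
by have := pW _ kv; rewrite bilZl bilZr /bil vW mul0mx mxE !mulr0 ltxx.
Qed.

Lemma not_posdef_null W : psd W -> ~ posdef W ->
  exists2 x, dot x x = 1 & bil W x x = 0.
Proof.
move=> pW; apply: contra_notP => H x x1.
rewrite lt_neqAle pW andbT eq_sym; apply/eqP => W0; apply: H; exists x => //.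
Qed.

Lemma null_rank W x : W^T = W -> psd W -> dot x x = 1 -> bil W x x = 0 -> (\rank W < n)%N.
Proof.
move=> sW pW x1 W0; rewrite ltn_neqAle rank_leq_row andbT; apply/negP => rW.
have xW : x *m W = 0 by apply: bil_eq0_mul => z; exact: psd_null_bil.
have : x = 0 by apply: (row_free_inj rW); rewrite xW mul0mx.
by move=> x0; move: x1; rewrite x0 /dot bil0l => /eqP; rewrite eq_sym oner_eq0.
Qed.

Lemma trace_rank_gt0 W : 0 < \tr W -> (0 < \rank W)%N.
Proof.
move=> tW; rewrite lt0n mxrank_eq0; apply/eqP => W0.
by move: tW; rewrite W0 mxtrace0 ltxx.
Qed.

(** For y orthogonal to x, [psd_le_trace2] leaves no room for W(y, y), so W kills the complement of
    x and factors through x. *)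
Lemma trace_attained_rank W x : W^T = W -> psd W -> dot x x = 1 -> bil W x x = \tr W ->
  (\rank W <= 1)%N.
Proof.
move=> sW pW x1 Wx.
have null y : dot x y = 0 -> y *m W = 0.
  move=> xy; apply: bil_eq0_mul => z; apply: psd_null_bil => //.
  have := psd_le_trace2 x y sW pW; rewrite xy x1 Wx expr0n /= => h.
  apply/eqP; rewrite eq_le pW andbT; have := dot_ge0 y; move: h; rewrite !mulr0 mul0r subr0 mul1r; lra.
have WE : W = x^T *m (x *m W).
  apply/row_matrixP => i; rewrite row_mul !rowE.
  apply/eqP; rewrite -subr_eq0 mulmxA -mulmxBl; apply/eqP; apply: null.
  rewrite dotDr dotNr dot_delta.
  have -> : delta_mx 0 i *m x^T *m x = x 0 i *: x.
    by rewrite -rowE (_ : row i x^T = (x 0 i)%:M) ?mul_scalar_mx//; apply/matrixP => a b; rewrite !ord1 !mxE.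
  by rewrite dotZr x1 mulr1 subrr.
by rewrite WE (leq_trans (mxrankM_maxl _ _))// rank_leq_col.
Qed.

(** If w spans the row space then W = D w, so tr W = w D and W(w, w) = (w D) |w|^2. *)
Lemma rank1_trace_attained W : 0 < \tr W -> (\rank W <= 1)%N ->
  exists2 x, dot x x = 1 & bil W x x = \tr W.
Proof.
move=> tW rW.
have W0 : W != 0 by rewrite -mxrank_eq0 -lt0n trace_rank_gt0.
have /rowV0Pn[w wW w0] := W0.
have Ww : (W <= w)%MS.
  rewrite -(mxrank_leqif_sup wW) eqn_leq (mxrankS wW) (leq_trans rW)//.
  by rewrite lt0n mxrank_eq0.
have /submxP[D WE] := Ww.
have tE : \tr W = (w *m D) 0 0 by rewrite WE mxtrace_mulC /mxtrace big_ord1.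
have [k kw] := unit_vector w0.
exists (k *: w) => //.
have -> : bil W (k *: w) (k *: w) = \tr W * dot (k *: w) (k *: w).
  rewrite bilZl bilZr dotZZ tE.
  have -> : bil W w w = (w *m D) 0 0 * dot w w.
    rewrite /bil {1}WE mulmxA -mulmxA row_trmul.
    by rewrite mul_mx_scalar mxE mulrC.
  ring.
by rewrite kw mulr1.
Qed.

End Ranks.

Theorem theorem3 (R : realType) (n : nat) (Omega : set 'rV[R]_n)
    (delta eps : R) (u : 'rV[R]_n * R -> R)
    (hn : n \in [:: 1; 2; 3]%N)
    (Omega_open : open Omega) (Omega_conn : connected Omega)
    (delta_gt0 : 0 < delta) (eps_gt0 : 0 < eps)
    (u_smooth : smooth_on (Omega `*` `]0, delta[) u)
    (u_eq : forall p : 'rV[R]_n * R,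
       (Omega `*` `]0, delta[) p -> donaldson eps u p)
    (u_psd : forall p : 'rV[R]_n * R,
       (Omega `*` `]0, delta[) p -> psd (hessian u p + 1%:M)) :
  forall p q : 'rV[R]_n * R,
    (Omega `*` `]0, delta[) p ->
    (Omega `*` `]0, delta[) q ->
    \rank (hessian u p + 1%:M)%R = \rank (hessian u q + 1%:M)%R.
Proof.
pose U := Omega `*` `]0, delta[.
suff main : forall p q, U p -> U q -> \rank (Wm u p) = \rank (Wm u q) by exact: main.
have I_open : open `]0, delta[%classic by exact: interval_open.
have I_conn : connected `]0, delta[%classic.
  by apply/connected_intervalP; exact: interval_is_interval.
have U_open : open U.
  rewrite openE => -[x t] [/= Ox It]; exists (Omega, `]0, delta[%classic) => //=.
  by split; apply: open_nbhs_nbhs; split.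
have sW p := Wm_sym U_open u_smooth (p := p).
have tW p := trace_Wm_gt0 eps_gt0 u_eq u_psd (p := p).
have loc := setX_locally_constant Omega_conn Omega_open I_conn I_open.
have W_cst := loc _ (posdef_locally_constant (S := fun p => posdef (Wm u p)) U_open
  (fun c r r0 b S p pc x x1 => Wm_propagation U_open eps_gt0 u_smooth u_eq u_psd r0 b S pc x1)).
have [[q0 [Uq0 pos0]]|nopos] := pselect (exists q, U q /\ posdef (Wm u q)).
  have rk p : U p -> \rank (Wm u p) = n.
    by move=> Up; apply: posdef_rank; exact: W_cst Uq0 Up pos0.
  by move=> p q Up Uq; exact: (etrans (rk p Up) (esym (rk q Uq))).
have degenerate p : U p -> exists2 e, dot e e = 1 & bil (Wm u p) e e = 0.
  move=> Up; apply: not_posdef_null; first exact: u_psd.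
  by move=> pos; apply: nopos; exists p.
have lt_n p : U p -> (0 < \rank (Wm u p) < n)%N.
  move=> Up; rewrite trace_rank_gt0/=; last exact: tW.
  have [e e1 We] := degenerate p Up.
  apply: (@null_rank _ _ (Wm u p) e (sW p Up)) => //; exact: u_psd.
have : (n = 3 \/ n <= 2)%N.
  by move: hn; rewrite !inE => /or3P[] /eqP ->; [right | right | left].
case=> [n3|n2] p q Up Uq; last first.
  have r1 z : U z -> \rank (Wm u z) = 1%N.
    by move=> /lt_n/andP[a b]; apply/eqP; rewrite eqn_leq a -ltnS (leq_trans b).
  exact: (etrans (r1 p Up) (esym (r1 q Uq))).
subst n.
have C_cst := loc _ (posdef_locally_constant (S := fun p => posdef (cotrace (Wm u p))) U_open
  (fun c r r0 b S p pc x x1 => cotrace_propagation U_open eps_gt0 u_smooth u_eq u_psd degenerate r0 b S pc x1)).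
(* Only ranks 1 and 2 remain. [cotrace] degenerates exactly when a unit vector attains tr W, that
   is, when the rank is 1. *)
have rk z : U z -> posdef (cotrace (Wm u z)) <-> \rank (Wm u z) = 2%N.
  move=> Uz; have /andP[r0 r3] := lt_n z Uz; split => [pos|r2].
    apply/eqP; rewrite eqn_leq -ltnS r3 ltnNge /=; apply/negP => r1.
    have [x x1 Wx] := rank1_trace_attained (tW z Uz) r1.
    by have := pos x x1; rewrite bil_cotrace Wx x1 mulr1 subrr ltxx.
  apply: contrapT => npos.
  have [x x1] := not_posdef_null (psd_cotrace (u_psd z Uz)) npos.
  rewrite bil_cotrace x1 mulr1 => /eqP; rewrite subr_eq0 => /eqP Wx.
  have r1 : (\rank (Wm u z) <= 1)%N.
    exact: (@trace_attained_rank _ _ (Wm u z) x (sW z Uz) (u_psd z Uz) x1 (esym Wx)).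
  by rewrite r2 in r1.
have pq := C_cst p q Up Uq; have qp := C_cst q p Uq Up.
have [rkp rkq] := (rk p Up, rk q Uq).
have cls (a b : nat) : (0 < a < 3)%N -> (0 < b < 3)%N -> (a = 2%N <-> b = 2%N) -> a = b.
  by case: a => [|[|[|a]]] //; case: b => [|[|[|b]]] // _ _ [h1 h2]; [have := h2 erefl | have := h1 erefl].
apply: (cls _ _ (lt_n p Up) (lt_n q Uq)); split => h.
  by apply: (proj1 rkq); apply: pq; exact: (proj2 rkp).
by apply: (proj1 rkp); apply: qp; exact: (proj2 rkq).
Qed.
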